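(* Consider a model of horizon $T$ whose potentials satisfy $G_t(x_{t-1},x_t)=G_t(x_t)$ for $t\ge2$, and suppose there is $G^*<\infty$ with $G_t(\cdot)\le G^*$ for all $t=1,\dots,T$. Then there exists a constant $c=c(G^*,T,c_T)\in(0,\infty)$, depending only on $G^*$, $T$ and $c_T$, such that for all $N\ge2$ and all $s_{\mathrm{ref}},\tilde s_{\mathrm{ref}}\in\mathsf{X}^T$, the output $(S,\tilde S)\leftarrow\mathrm{CCPF}(s_{\mathrm{ref}},\tilde s_{\mathrm{ref}},N)$ satisfies $$\mathbb{P}(S=\tilde S)\ge1-\frac{c}{N+c}.$$
   Context: Model. $\mathsf{X}$ is a measurable space with a $\sigma$-finite measure written $\mathrm{d}x$. A model of horizon $T$ (with potentials depending only on the current state) consists of a probability density $M_1$ on $\mathsf{X}$, Markov transition densities $M_t(x_{t-1},x_t)$ (densities in $x_t$), $t=2,\dots,T$, and measurable potentials $G_t:\mathsf{X}\to[0,\infty)$, $t=1,\dots,T$, with $c_T=\int M_1(x_1)G_1(x_1)\prod_{t=2}^T M_t(x_{t-1},x_t)G_t(x_t)\,\mathrm{d}x_{1:T}\in(0,\infty)$. Coupled resampling $\mathrm{CRes}(\omega^{(1:N)},\tilde\omega^{(1:N)},n)$: let $w^{(i)}=\omega^{(i)}/\sum_j\omega^{(j)}$, $\tilde w^{(i)}=\tilde\omega^{(i)}/\sum_j\tilde\omega^{(j)}$, $p_c=\sum_j w^{(j)}\wedge\tilde w^{(j)}$, $w_c=(w\wedge\tilde w)/p_c$, $w_r=(w-w\wedge\tilde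 w)/(1-p_c)$, $\tilde w_r=(\tilde w-w\wedge\tilde w)/(1-p_c)$. Independently for $i=1,\dots,n$: with probability $p_c$ draw $I^{(i)}=\tilde I^{(i)}\sim w_c$; otherwise draw independently $I^{(i)}\sim w_r$, $\tilde I^{(i)}\sim\tilde w_r$. Output $(I^{(1:n)},\tilde I^{(1:n)})$. $\mathrm{CCPF}(X^*_{1:T},\tilde X^*_{1:T},N)$ (coupled conditional particle filter): 1. $(X_{1:T}^{(1)},\tilde X_{1:T}^{(1)})=(X^*_{1:T},\tilde X^*_{1:T})$; for $i=2,\dots,N$ independently $X_1^{(i)}=\tilde X_1^{(i)}\sim M_1$; $\omega_1^{(i)}=G_1(X_1^{(i)})$, $\tilde\omega_1^{(i)}=G_1(\tilde X_1^{(i)})$ for $i=1,\dots,N$. 2. For $t=2,\dots,T$: $I_t^{(1)}=\tilde I_t^{(1)}=1$; $(I_t^{(2:N)},\tilde I_t^{(2:N)})\leftarrow\mathrm{CRes}(\omega_{t-1}^{(1:N)},\tilde\omega_{t-1}^{(1:N)},N-1)$; conditionally independently over $i=2,\dots,N$: if $X_{t-1}^{(I_t^{(i)})}=\tilde X_{t-1}^{(\tilde I_t^{(i)})}$ draw $X_t^{(i)}=\tilde X_t^{(i)}\sim M_t(X_{t-1}^{(I_t^{(i)})},\cdot)$, otherwise draw $(X_t^{(i)},\tilde X_t^{(i)})$ from any (fixed, measurable) coupling of $M_t(X_{t-1}^{(I_t^{(i)})},\cdot)$ and $M_t(\tilde X_{t-1}^{(\tilde I_t^{(i)})},\cdot)$;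 set $\omega_t^{(i)}=G_t(X_t^{(i)})$, $\tilde\omega_t^{(i)}=G_t(\tilde X_t^{(i)})$ for $i=1,\dots,N$. 3. $(J_T,\tilde J_T)\leftarrow\mathrm{CRes}(\omega_T^{(1:N)},\tilde\omega_T^{(1:N)},1)$; for $t=T-1,\dots,1$: $(J_t,\tilde J_t)=(I_{t+1}^{(J_{t+1})},\tilde I_{t+1}^{(\tilde J_{t+1})})$. 4. Output $(X_{1:T}^{(J_{1:T})},\tilde X_{1:T}^{(\tilde J_{1:T})})$, where $X_{1:T}^{(J_{1:T})}=(X_1^{(J_1)},\dots,X_T^{(J_T)})$. *)

(* Defs.v *)
From HB Require Import structures.
From mathcomp Require Import all_boot all_order all_algebra.
From mathcomp Require Import all_classical all_reals all_analysis.
From mathcomp Require Import measurable_realfun.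

Set Implicit Arguments.
Unset Strict Implicit.
Unset Printing Implicit Defensive.
Import Order.TTheory GRing.Theory Num.Theory.
Import numFieldNormedType.Exports.

Local Open Scope classical_set_scope.
Local Open Scope ring_scope.
Local Open Scope ereal_scope.

(* Index sets carry the discrete sigma-algebra. *)
HB.instance Definition _ n := isPointed.Build 'I_n.+1 ord0.
HB.instance Definition _ n := @isMeasurable.Build default_measure_display
  'I_n.+1 (@discrete_measurable _) (@discrete_measurable0 _)
  (@discrete_measurableC _) (@discrete_measurableU _).

Section measurability.

Lemma measurable_invr (R : realType) : measurable_fun [set: R] (fun x => x^-1)%R.
Proof.
rewrite (_ : (fun x => x^-1)%R =
  (fun x : R => if (0 <= x)%R then x `^ (-1) else - (- x) `^ (-1))%R).
  apply: measurable_fun_ifT.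
  - by apply: measurable_fun_ler.
  - exact: measurable_powR.
  - apply: measurable_funN.
    have h : measurable_fun [set: R] ((@powR R ^~ (-1)%R) \o (fun x => - x)%R).
      by apply: measurableT_comp; [exact: measurable_powR|exact: oppr_measurable].
    exact: h.
apply/funext => x; case: ifPn => [x0|]; first by rewrite powR_inv1.
by rewrite -ltNge => x0; rewrite powR_inv1 ?oppr_ge0 1?ltW// invrN opprK.
Qed.

Lemma measurable_discr d d' n (T : measurableType d) (Z : measurableType d')
    (f : T * 'I_n.+1 -> Z) :
  (forall i, measurable_fun setT (fun x => f (x, i))) -> measurable_fun setT f.
Proof.
move=> mf _ B mB; rewrite setTI.
rewrite (_ : f @^-1` B = \big[setU/set0]_(i < n.+1)
  (((fun x => f (x, i)) @^-1` B) `*` [set i])).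
  apply: bigsetU_measurable => i _; apply: measurableX => //.
  by rewrite -[X in measurable X]setTI; exact: mf.
apply/seteqP; split => [[x i] /= Bxi|[x i]].
  by rewrite (bigD1 i)//=; left.
elim/big_ind : _ => //=; first by move=> A C IA IC [/IA|/IC].
by move=> j _ [] /= + ->.
Qed.

Lemma measurable_rcons d d' (T : measurableType d) (T' : measurableType d')
    n (f : T -> T') (g : T -> n.-tuple T') :
  measurable_fun setT f -> measurable_fun setT g ->
  measurable_fun setT (fun x => [tuple of rcons (g x) (f x)]).
Proof.
move=> mf mg; apply/measurable_fun_tnthP => i.
have [ilt|ige] := ltnP i n.
  rewrite (_ : _ \o _ = (fun s => tnth s (Ordinal ilt)) \o g).
    by apply: measurableT_comp => //; exact: measurable_tnth.
  apply/funext => x /=; rewrite !(tnth_nth point)/= nth_rcons size_tuple.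
  by rewrite ilt.
rewrite (_ : _ \o _ = f)//; apply/funext => x /=.
have /eqP ein : i == n :> nat by rewrite eqn_leq ige -ltnS ltn_ord.
by rewrite (tnth_nth point)/= nth_rcons size_tuple ein ltnn eqxx.
Qed.

End measurability.

Section kernel_combinators.
Context d d' (H : measurableType d) (Y : measurableType d') (R : realType).

Section from_measures.
Variable k : H -> {measure set Y -> \bar R}.
Hypotheses (mk : forall U, measurable U -> measurable_fun [set: H] (k ^~ U))
  (k1 : forall h, k h setT = 1).

Definition mkker (_ : forall U, measurable U -> measurable_fun [set: H] (k ^~ U))
  (_ : forall h, k h setT = 1) : H -> {measure set Y -> \bar R} := k.

HB.instance Definition _ := isKernel.Build _ _ H Y R (mkker mk k1) mk.

HB.instance Definition _ :=
  Kernel_isProbability.Build _ _ H Y R (mkker mk k1) k1.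

Definition pker_of : R.-pker H ~> Y := mkker mk k1.

End from_measures.

Section from_set_function.
Variable k : H -> set Y -> \bar R.
Hypotheses (k0 : forall h, k h set0 = 0) (k_ge0 : forall h U, 0 <= k h U)
  (k_sigma : forall h, semi_sigma_additive (k h)).

Definition measure_fam_of (h : H) : {measure set Y -> \bar R} :=
  HB.pack (k h) (isMeasure.Build _ Y R (k h) (k0 h) (@k_ge0 h) (@k_sigma h)).

End from_set_function.

Section kdensity.
Variables (mu : {sigma_finite_measure set Y -> \bar R}) (f : H -> Y -> R).
Hypotheses (mf : measurable_fun setT (fun p : H * Y => f p.1 p.2))
  (f_ge0 : forall h y, (0 <= f h y)%R)
  (f1 : forall h, \int[mu]_y (f h y)%:E = 1).

Let k h (A : set Y) := \int[mu]_(y in A) (f h y)%:E.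

Let mfh h : measurable_fun setT (fun y => (f h y)%:E).
Proof.
apply/measurable_EFinP.
exact: (measurableT_comp mf (pair1_measurable h)).
Qed.

Let k0 h : k h set0 = 0. Proof. by rewrite /k integral_set0. Qed.

Let k_ge0 h A : 0 <= k h A.
Proof. by apply: integral_ge0 => y _; rewrite lee_fin. Qed.

Let k_sigma h : semi_sigma_additive (k h).
Proof.
apply: (semi_sigma_additive_nng_induced (f := fun y => (f h y)%:E)) => //.
by move=> y; rewrite lee_fin.
Qed.

Let mk A : measurable A -> measurable_fun setT (k ^~ A).
Proof.
move=> mA; rewrite /k.
under eq_fun do rewrite integral_mkcond.
apply: (measurable_fun_fubini_tonelli_F (m2 := mu)
  (fun p => ((fun y => (f p.1 y)%:E) \_ A) p.2)) => [|p]; last first.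
  by rewrite patchE; case: ifP => // _; rewrite lee_fin.
rewrite (_ : (fun p => _) = (fun p => (f p.1 p.2)%:E) \_ (setT `*` A)).
  apply/(measurable_restrictT _ _).1.
    exact: measurableX.
  by apply: measurable_funTS; exact/measurable_EFinP.
by apply/funext => -[h y]; rewrite !patchE/= in_setX in_setT.
Qed.

(* h |-> f h y mu(dy) *)
Definition kdensity : R.-pker H ~> Y :=
  @pker_of (measure_fam_of k0 k_ge0 k_sigma) mk f1.

End kdensity.
End kernel_combinators.

Section kdiscrete.
Context d d' (H : measurableType d) (Y : measurableType d') (R : realType).
Variables (I : finType) (e : I -> Y) (p : H -> I -> R).
Hypotheses (mp : forall i, measurable_fun setT (p ^~ i))
  (p_ge0 : forall h i, (0 <= p h i)%R) (p1 : forall h, (\sum_i p h i = 1)%R).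

Let k h (A : set Y) := \sum_(i : I) (p h i)%:E * \d_(e i) A.

Let k0 h : k h set0 = 0.
Proof. by rewrite /k big1// => i _; rewrite measure0 mule0. Qed.

Let k_ge0 h A : 0 <= k h A.
Proof. by apply: sume_ge0 => i _; rewrite mule_ge0// lee_fin. Qed.

Let k_sigma h : semi_sigma_additive (k h).
Proof.
move=> F mF tF mUF.
rewrite (_ : (fun n => _) = (fun n =>
    \sum_(i : I) (p h i)%:E * \sum_(0 <= j < n) \d_(e i) (F j))); last first.
  apply/funext => n; rewrite exchange_big/=; apply: eq_bigr => i _.
  by rewrite ge0_sume_distrr.
apply: cvg_nnesum => i _.
  by apply: nearW => n; rewrite mule_ge0 ?lee_fin ?sume_ge0.
by apply: cvgeZl => //; exact: measure_semi_sigma_additive.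
Qed.

Let mk A : measurable A -> measurable_fun setT (k ^~ A).
Proof.
move=> mA; apply: emeasurable_sum => i.
under eq_fun do rewrite muleC.
by apply: emeasurable_funM => //; exact/measurable_EFinP.
Qed.

Let k1 h : k h setT = 1.
Proof.
rewrite /k -[RHS]/(1%:E) -(p1 h) -sumEFin.
by apply: eq_bigr => i _; rewrite diracT mule1.
Qed.

(* h |-> law of e i, where i has probability p h i *)
Definition kdiscrete : R.-pker H ~> Y :=
  @pker_of _ _ _ _ _ (measure_fam_of k0 k_ge0 k_sigma) mk k1.

End kdiscrete.

Definition kret d d' (H : measurableType d) (Y : measurableType d')
  (R : realType) (f : H -> Y) (mf : measurable_fun setT f) : R.-pker H ~> Y :=
  kdirac mf.
Arguments kret {d d' H Y R f}.

Section kcomap.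
Context d d' d'' (H' : measurableType d'') (H : measurableType d)
  (Y : measurableType d') (R : realType).
Variables (f : H' -> H) (mf : measurable_fun setT f) (k : R.-pker H ~> Y).

Let mk A : measurable A -> measurable_fun setT (fun h => k (f h) A).
Proof.
by move=> mA; apply: (measurableT_comp (measurable_kernel k _ mA)).
Qed.

Definition kcomap : R.-pker H' ~> Y :=
  pker_of (k := fun h => k (f h)) mk (fun h => prob_kernel (f h)).

End kcomap.

Section kite.
Context d d' (H : measurableType d) (Y : measurableType d') (R : realType).
Variables (A : set H) (mA : measurable A) (k1 k2 : R.-pker H ~> Y).

Let k h : {measure set Y -> \bar R} := if h \in A then k1 h else k2 h.

Let mk B : measurable B -> measurable_fun setT (k ^~ B).
Proof.
move=> mB; rewrite (_ : (fun h => _) =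
    (fun h => if h \in A then k1 h B else k2 h B)); last first.
  by apply/funext => h; rewrite /k; case: ifP.
apply: measurable_fun_ifT; [|exact: measurable_kernel|exact: measurable_kernel].
by apply: (measurable_fun_bool true) => //; rewrite setTI preimage_mem_true.
Qed.

Let k_setT h : k h setT = 1.
Proof. by rewrite /k; case: ifP => _; exact: prob_kernel. Qed.

Definition kite : R.-pker H ~> Y := pker_of mk k_setT.

End kite.

Section kbind.
Context d d' d'' (H : measurableType d) (Y : measurableType d')
  (Z : measurableType d'') (R : realType).
Variables (l : R.-pker H ~> Y) (k : R.-pker (H * Y) ~> Z).

Let mk A : measurable A -> measurable_fun setT ((l \; k) ^~ A).
Proof. exact: measurable_kernel. Qed.

Let k1 h : (l \; k) h setT = 1.
Proof.
rewrite /= /kcomp; under eq_integral do rewrite prob_kernel.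
by rewrite integral_cst// mul1e prob_kernel.
Qed.

(* draw y from l h, then z from k (h, y), and return z *)
Definition kbind : R.-pker H ~> Z := pker_of mk k1.

End kbind.

Section kiid.
Context d d' (H : measurableType d) (Y : measurableType d') (R : realType).
Variable k : R.-pker H ~> Y.

Let mcons n : measurable_fun setT
  (fun p : H * Y * n.-tuple Y => [the n.+1.-tuple Y of p.1.2 :: p.2]).
Proof.
apply: measurable_cons => //.
by apply: (measurableT_comp measurable_snd); exact: measurable_fst.
Qed.

(* n independent draws from k h *)
Fixpoint kiid n : R.-pker H ~> n.-tuple Y :=
  match n with
  | 0 => kret (measurable_cst [tuple])
  | m.+1 => kbind k (kbind (kcomap measurable_fst (kiid m)) (kret (@mcons m)))
  end.

End kiid.

Section kernel_at.
Context d d' (H : measurableType d) (Y : measurableType d') (R : realType).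
Variables (k : R.-pker H ~> Y) (h : H).

Definition kat : set Y -> \bar R := k h.

HB.instance Definition _ := Measure.on kat.

HB.instance Definition _ :=
  Measure_isProbability.Build _ _ _ kat (prob_kernel h).

Definition kernel_at : probability Y R := kat.

End kernel_at.

Section feynman_kac_model.
Context d (X : measurableType d) (R : realType).
Variable mu : {sigma_finite_measure set X -> \bar R}.

(* Times are numbered from 1: [init_dens] is the density at time 1,
   [trans_dens t x] is the density at time t given x at time t - 1; for a model
   of horizon T only the transitions 2 <= t <= T and the potentials
   1 <= t <= T play a role. *)
Record model := Model {
  init_dens : X -> R ;
  trans_dens : nat -> X -> X -> R ;
  potential : nat -> X -> R ;
  measurable_init_dens : measurable_fun [set: X] init_dens ;
  init_dens_ge0 : forall x, (0 <= init_dens x)%R ;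
  init_dens_int : \int[mu]_x (init_dens x)%:E = 1 ;
  measurable_trans_dens : forall t,
    measurable_fun [set: X * X] (fun p => trans_dens t p.1 p.2) ;
  trans_dens_ge0 : forall t x y, (0 <= trans_dens t x y)%R ;
  trans_dens_int : forall t x, \int[mu]_y (trans_dens t x y)%:E = 1 ;
  measurable_potential : forall t, measurable_fun [set: X] (potential t) ;
  potential_ge0 : forall t x, (0 <= potential t x)%R }.

(* Integral over X^T against the product measure dx_1 ... dx_T, written as an
   iterated integral; it is only applied to a nonnegative measurable integrand,
   for which the two agree by Tonelli. *)
Fixpoint iterated_integral (T : nat) (f : seq X -> \bar R) : \bar R :=
  match T with
  | 0 => f [::]
  | T'.+1 => \int[mu]_x iterated_integral T' (fun s => f (x :: s))
  end.

Definition normalizing_constant (m : model) (T : nat) : \bar R :=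
  iterated_integral T (fun s : seq X =>
    let x t := nth point s t.-1 in
    (init_dens m (x 1%N) * potential m 1 (x 1%N) *
     \prod_(2 <= t < T.+1) (trans_dens m t (x t.-1) (x t) *
                            potential m t (x t)))%R%:E).

Definition init_kernel d' (H : measurableType d') (m : model) : R.-pker H ~> X :=
  @kdensity _ _ H X R mu (fun=> init_dens m)
    (measurableT_comp (measurable_init_dens m) measurable_snd)
    (fun=> init_dens_ge0 m) (fun=> init_dens_int m).

Definition trans_kernel (m : model) (t : nat) : R.-pker X ~> X :=
  kdensity (mu := mu) (measurable_trans_dens m t) (trans_dens_ge0 m t)
    (trans_dens_int m t).

(* K t (x, x') need only be a coupling for x <> x', since equal particles are
   moved together. *)
Definition is_coupling_upto (m : model) (T : nat)
    (K : nat -> R.-pker (X * X) ~> (X * X)%type) : Prop :=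
  forall t x x', (2 <= t <= T)%N -> x <> x' ->
  forall A, measurable A ->
    K t (x, x') (A `*` setT) = trans_kernel m t x A /\
    K t (x, x') (setT `*` A) = trans_kernel m t x' A.

End feynman_kac_model.

Record prob_vector (R : realType) (n : nat) := ProbVector {
  pvec :> 'I_n -> R ;
  pvec_ge0 : forall i, (0 <= pvec i)%R ;
  pvec_sum1 : (\sum_i pvec i = 1)%R }.

Section coupled_resampling_weights.
Local Open Scope ring_scope.
Context (R : realType) (n : nat).
Implicit Types (v : prob_vector R n) (w : 'I_n -> R).

(* The quotient is undefined when all the weights vanish: an arbitrary
   probability vector [v] is used in that case. *)
Definition normalized v w (i : 'I_n) : R :=
  if \sum_j w j == 0 then v i else w i / \sum_j w j.

Section pmf.
Variables w w' : 'I_n -> R.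

Definition coupling_prob : R := \sum_j Num.min (w j) (w' j).

Definition common_part (i : 'I_n) : R := Num.min (w i) (w' i) / coupling_prob.

Definition residual_part (u : 'I_n -> R) (i : 'I_n) : R :=
  (u i - Num.min (w i) (w' i)) / (1 - coupling_prob).

(* Joint law of one pair of indices, for normalized weights [w] and [w']. The
   quotients above are x / 0 = 0 when [coupling_prob] is 0 or 1, and they are
   then multiplied by 0. *)
Definition cres_pmf (ij : 'I_n * 'I_n) : R :=
  coupling_prob * (if ij.1 == ij.2 then common_part ij.1 else 0) +
  (1 - coupling_prob) * (residual_part w ij.1 * residual_part w' ij.2).

End pmf.

Lemma normalized_ge0 v w i : (forall j, 0 <= w j) -> 0 <= normalized v w i.
Proof.
move=> w0; rewrite /normalized; case: ifP => _; first exact: pvec_ge0.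
by rewrite divr_ge0// sumr_ge0.
Qed.

Lemma normalized_sum1 v w : \sum_i normalized v w i = 1.
Proof.
rewrite /normalized; have [_|w0] := eqVneq (\sum_j w j) 0.
  exact: pvec_sum1.
by rewrite -mulr_suml divff.
Qed.

Variables w w' : 'I_n -> R.
Hypotheses (w_ge0 : forall i, 0 <= w i) (w'_ge0 : forall i, 0 <= w' i).
Hypotheses (w1 : \sum_i w i = 1) (w'1 : \sum_i w' i = 1).

Let pc := coupling_prob w w'.

Let pc_ge0 : 0 <= pc.
Proof. by apply: sumr_ge0 => i _; rewrite le_min w_ge0 w'_ge0. Qed.

Let pc_le1 : pc <= 1.
Proof. by rewrite -w1; apply: ler_sum => i _; rewrite ge_min lexx. Qed.

Let common_sum : pc * \sum_i common_part w w' i = pc.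
Proof.
rewrite -mulr_suml -/pc; have [->|pc0] := eqVneq pc 0; first by rewrite mul0r.
by rewrite -/(coupling_prob w w') -/pc divff// mulr1.
Qed.

Let residual_sum u : \sum_i u i = 1 -> pc != 1 ->
  \sum_i residual_part w w' u i = 1.
Proof.
move=> u1 pcN1; rewrite -mulr_suml sumrB u1 -/(coupling_prob w w') -/pc.
by rewrite divff// subr_eq0 eq_sym.
Qed.

Lemma cres_pmf_ge0 ij : 0 <= cres_pmf w w' ij.
Proof.
have min_ge0 i : 0 <= Num.min (w i) (w' i) by rewrite le_min w_ge0 w'_ge0.
have pc1 : 0 <= 1 - coupling_prob w w' by rewrite subr_ge0.
rewrite /cres_pmf addr_ge0// mulr_ge0//.
  by case: ifP => // _; rewrite divr_ge0.
by rewrite mulr_ge0// divr_ge0// subr_ge0 ge_min lexx ?orbT.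
Qed.

Lemma cres_pmf_sum1 : \sum_ij cres_pmf w w' ij = 1.
Proof.
rewrite big_split/= -!mulr_sumr -/pc.
have -> : \sum_(ij : 'I_n * 'I_n)
    (if ij.1 == ij.2 then common_part w w' ij.1 else 0) =
    \sum_i common_part w w' i.
  rewrite -(pair_bigA _ (fun i j => if i == j then common_part w w' i else 0))/=.
  apply: eq_bigr => i _; rewrite (bigD1 i)//= eqxx big1 ?addr0// => j ji.
  by rewrite eq_sym (negbTE ji).
rewrite common_sum.
rewrite -(pair_bigA _ (fun i j =>
  residual_part w w' w i * residual_part w w' w' j))/=.
have [->|pcN1] := eqVneq pc 1; first by rewrite subrr mul0r addr0.
under eq_bigr do rewrite -mulr_sumr residual_sum// mulr1.
by rewrite residual_sum// mulr1 addrC subrK.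
Qed.

End coupled_resampling_weights.

Section coupled_resampling.
Context d (H : measurableType d) (R : realType) (n : nat).
Variables (v : prob_vector R n.+1) (w w' : H -> 'I_n.+1 -> R).
Hypotheses (mw : forall i, measurable_fun setT (w ^~ i))
  (mw' : forall i, measurable_fun setT (w' ^~ i))
  (w_ge0 : forall h i, (0 <= w h i)%R) (w'_ge0 : forall h i, (0 <= w' h i)%R).

Let mnormalized (u : H -> 'I_n.+1 -> R) i :
  (forall j, measurable_fun setT (u ^~ j)) ->
  measurable_fun setT (fun h => normalized v (u h) i).
Proof.
move=> mu; have msum : measurable_fun setT (fun h => \sum_j u h j)%R.
  exact: measurable_sum.
apply: measurable_fun_ifT => //; first exact: measurable_fun_eqr.
apply: measurable_funM => //.
exact: (measurableT_comp (@measurable_invr R)).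
Qed.

Let pmf h := cres_pmf (normalized v (w h)) (normalized v (w' h)).

Let mpmf ij : measurable_fun setT (pmf ^~ ij).
Proof.
have mm j : measurable_fun setT
    (fun h => Num.min (normalized v (w h) j) (normalized v (w' h) j)).
  by apply: measurable_minr; exact: mnormalized.
have mpc : measurable_fun setT
    (fun h => coupling_prob (normalized v (w h)) (normalized v (w' h))).
  exact: measurable_sum.
have mpcV : measurable_fun setT
    (fun h => (coupling_prob (normalized v (w h)) (normalized v (w' h)))^-1)%R.
  exact: (measurableT_comp (@measurable_invr R)).
have mpc' : measurable_fun setT
    (fun h => 1 - coupling_prob (normalized v (w h)) (normalized v (w' h)))%R.
  exact: measurable_funB.
have mpc'V : measurable_fun setT (fun h =>
    (1 - coupling_prob (normalized v (w h)) (normalized v (w' h)))^-1)%R.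
  exact: (measurableT_comp (@measurable_invr R)).
rewrite /pmf /cres_pmf; apply: measurable_funD; apply: measurable_funM => //.
  by have [_|_] := eqVneq ij.1 ij.2 => //; exact: measurable_funM.
by apply: measurable_funM; apply: measurable_funM => //;
  apply: measurable_funB => //; exact: mnormalized.
Qed.

Let pmf_ge0 h ij : (0 <= pmf h ij)%R.
Proof.
apply: cres_pmf_ge0; rewrite ?normalized_sum1// => i; exact: normalized_ge0.
Qed.

Let pmf_sum1 h : (\sum_ij pmf h ij = 1)%R.
Proof.
apply: cres_pmf_sum1; rewrite ?normalized_sum1// => i; exact: normalized_ge0.
Qed.

Definition cres : R.-pker H ~> ('I_n.+1 * 'I_n.+1)%type :=
  @kdiscrete _ _ H _ R _ (fun ij : 'I_n.+1 * 'I_n.+1 => ij) pmf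
    mpmf pmf_ge0 pmf_sum1.

End coupled_resampling.

Section coupled_conditional_particle_filter.
Context d (X : measurableType d) (R : realType).
Variable mu : {sigma_finite_measure set X -> \bar R}.
Variable m : model mu.
(* Without this the comparison of two particles, and the event that the two
   output trajectories are equal, would not be measurable. *)
Hypothesis mdiag : measurable [set p : X * X | p.1 = p.2].
Variable K : nat -> R.-pker (X * X) ~> (X * X)%type.
(* There are n + 1 particles, numbered from 0: [ord0] is the reference one. *)
Variables (n : nat) (v : prob_vector R n.+1).
Variables (T : nat) (sref sref' : T.-tuple X).

(* A particle at time t is a pair (ancestor index, position); the ancestor
   index is meaningless for t = 1. *)
Local Notation particle := ('I_n.+1 * X)%type.
Local Notation particle_pair := (particle * particle)%type.
Local Notation generation := (n.+1.-tuple particle_pair).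

Let mpos (side : particle_pair -> particle) :
  measurable_fun setT side ->
  measurable_fun setT (fun p : generation * 'I_n.+1 => (side (tnth p.1 p.2)).2).
Proof.
move=> mside; apply: measurable_discr => i /=.
apply: (measurableT_comp measurable_snd); apply: (measurableT_comp mside).
exact: measurable_tnth.
Qed.

Let mposi (side : particle_pair -> particle) i :
  measurable_fun setT side ->
  measurable_fun setT (fun g : generation => (side (tnth g i)).2).
Proof.
move=> mside; apply: (measurableT_comp measurable_snd).
apply: (measurableT_comp mside); exact: measurable_tnth.
Qed.

Definition weight (side : particle_pair -> particle) (t : nat) (g : generation)
  (i : 'I_n.+1) : R := potential m t (side (tnth g i)).2.

Let mweight side t i : measurable_fun setT side ->
  measurable_fun setT (fun g => weight side t g i).
Proof.
move=> mside.
exact: (measurableT_comp (measurable_potential m t) (mposi i mside)).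
Qed.

Definition resample (t : nat) : R.-pker generation ~> ('I_n.+1 * 'I_n.+1)%type :=
  cres v (w := weight fst t) (w' := weight snd t)
    (fun i => mweight t i measurable_fst) (fun i => mweight t i measurable_snd)
    (fun g i => potential_ge0 m t _) (fun g i => potential_ge0 m t _).

Let mdup d' (H : measurableType d') :
  measurable_fun setT (fun p : H * X => (p.2, p.2)).
Proof. by apply: measurable_fun_pair. Qed.

Definition mutate (t : nat) : R.-pker (X * X) ~> (X * X)%type :=
  kite mdiag
    (kbind (kcomap measurable_fst (trans_kernel m t)) (kret (@mdup _ _)))
    (K t).

Let minit d' (H : measurableType d') :
  measurable_fun setT (fun p : H * X => ((ord0, p.2), (ord0, p.2)) : particle_pair).
Proof. by apply: measurable_fun_pair; apply: measurable_fun_pair. Qed.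

(* Law of (X_1^(i), X~_1^(i)), for i <> ord0. *)
Definition initial_pair d' (H : measurableType d') : R.-pker H ~> particle_pair :=
  kbind (init_kernel H m) (kret (@minit _ H)).

Let mselect : measurable_fun setT (fun p : generation * ('I_n.+1 * 'I_n.+1) =>
  ((tnth p.1 p.2.1).1.2, (tnth p.1 p.2.2).2.2)).
Proof.
apply: measurable_fun_pair.
  apply: (measurableT_comp (mpos measurable_fst)
    (g := fun p : generation * ('I_n.+1 * 'I_n.+1) => (p.1, p.2.1))).
  by apply: measurable_fun_pair => //; exact: measurableT_comp.
apply: (measurableT_comp (mpos measurable_snd)
  (g := fun p : generation * ('I_n.+1 * 'I_n.+1) => (p.1, p.2.2))).
by apply: measurable_fun_pair => //; exact: measurableT_comp.
Qed.

Let mattach : measurable_fun setT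
  (fun p : generation * ('I_n.+1 * 'I_n.+1) * (X * X) =>
    ((p.1.2.1, p.2.1), (p.1.2.2, p.2.2)) : particle_pair).
Proof.
apply: measurable_fun_pair; apply: measurable_fun_pair;
  do 2?apply: measurableT_comp => //; exact: measurableT_comp.
Qed.

(* Law of ((I_t^(i), X_t^(i)), (I~_t^(i), X~_t^(i))), for i <> ord0 and t >= 2,
   given the generation t - 1. *)
Definition next_pair (t : nat) : R.-pker generation ~> particle_pair :=
  kbind (resample t.-1) (kbind (kcomap mselect (mutate t)) (kret mattach)).

(* The history up to time t lists the generations t, t - 1, ..., 1. *)
Local Notation history t := (t.-tuple generation).

Let mthead t : measurable_fun setT (fun h : history t.+1 => thead h).
Proof. exact: measurable_tnth. Qed.

(* Law of the pairs of particles other than [ord0] at time t + 1. *)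
Definition free_pairs (t : nat) : R.-pker history t ~> n.-tuple particle_pair :=
  match t with
  | 0 => kiid (initial_pair _) n
  | t'.+1 => kcomap (@mthead t') (kiid (next_pair t'.+2) n)
  end.

Definition reference_pair (t : nat) : particle_pair :=
  ((ord0, nth point sref t.-1), (ord0, nth point sref' t.-1)).

Let mrecord t (r : particle_pair) : measurable_fun setT
  (fun p : unit * history t * n.-tuple particle_pair =>
    [the t.+1.-tuple generation of
      [the n.+1.-tuple particle_pair of r :: p.2] :: p.1.2]).
Proof.
apply: measurable_cons; last exact: measurableT_comp.
exact: measurable_cons.
Qed.

Fixpoint history_law (t : nat) : R.-pker unit ~> history t :=
  match t with
  | 0 => kret (measurable_cst [tuple])
  | t'.+1 =>
      kbind (history_law t') (kbind (kcomap measurable_snd (free_pairs t'))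
        (kret (@mrecord t' (reference_pair t'.+1))))
  end.

(* Law of (J_T, J~_T) given the history up to time T; T = 0 is a dummy case. *)
Definition final_indices (t : nat) :
    R.-pker history t ~> ('I_n.+1 * 'I_n.+1)%type :=
  match t with
  | 0 => kret (measurable_cst (ord0, ord0))
  | t'.+1 => kcomap (@mthead t') (resample t'.+1)
  end.

(* The trajectory (x_1, ..., x_t) ending in the particle j at time t. *)
Fixpoint ancestral_path (side : particle_pair -> particle) (t : nat) :
    history t -> 'I_n.+1 -> t.-tuple X :=
  match t with
  | 0 => fun _ _ => [tuple]
  | t'.+1 => fun h j =>
      let p := side (tnth (thead h) j) in
      [tuple of rcons (ancestral_path side [tuple of behead h] p.1) p.2]
  end.

Let mpath side t : measurable_fun setT side ->
  measurable_fun setT (fun p : history t * 'I_n.+1 => ancestral_path side p.1 p.2).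
Proof.
move=> mside; elim: t => [|t IHt] /=; first exact: measurable_cst.
apply: measurable_discr => j /=.
have mp : measurable_fun setT
    (fun h : history t.+1 => side (tnth (thead h) j)).
  apply: (measurableT_comp mside).
  apply: (measurableT_comp (measurable_tnth j)); exact: mthead.
apply: measurable_rcons; first exact: (measurableT_comp measurable_snd mp).
apply: (measurableT_comp IHt (g := fun h : history t.+1 =>
  ([tuple of behead h] : history t, (side (tnth (thead h) j)).1))).
apply: measurable_fun_pair; first exact: measurable_behead.
exact: (measurableT_comp measurable_fst mp).
Qed.

Let moutput : measurable_fun setT
  (fun p : unit * history T * ('I_n.+1 * 'I_n.+1) =>
    (ancestral_path fst p.1.2 p.2.1, ancestral_path snd p.1.2 p.2.2)).
Proof.
have mcomp side (f : 'I_n.+1 * 'I_n.+1 -> 'I_n.+1) :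
    measurable_fun setT side -> measurable_fun setT f ->
    measurable_fun setT ((fun p => ancestral_path side p.1 p.2) \o
      (fun p : unit * history T * ('I_n.+1 * 'I_n.+1) => (p.1.2, f p.2))).
  move=> mside mf; apply: measurableT_comp; first exact: mpath.
  by apply: measurable_fun_pair; exact: measurableT_comp.
apply: measurable_fun_pair.
  exact: (mcomp fst fst measurable_fst measurable_fst).
exact: (mcomp snd snd measurable_snd measurable_snd).
Qed.

Definition ccpf_kernel : R.-pker unit ~> (T.-tuple X * T.-tuple X)%type :=
  kbind (history_law T)
    (kbind (kcomap measurable_snd (final_indices T)) (kret moutput)).

Definition ccpf_law : probability (T.-tuple X * T.-tuple X)%type R :=
  kernel_at ccpf_kernel tt.

End coupled_conditional_particle_filter.

(* Main.v *)
(* Let [n + 1] be the number of particles and call a particle coupled when it is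
   not the reference particle and its two ancestral paths agree.  For a function
   [phi] of the state and a history up to time [t], let [S] be the sum of [phi]
   over the coupled particles and [U] the number of the other ones, and let the
   score be [S / (S + a U)].  If [phi] is the last potential, then the score with
   a suitable [a] is a lower bound for the conditional probability that the
   output paths agree.  Given the past, the free particles are independent, so
   convexity of [1 / x] bounds the conditional mean of a score from below by a
   score one step earlier, in which [phi] is replaced by its image under one
   backward Feynman-Kac step and [a] by a larger constant: no power of [n] is
   lost, because [U >= 1] and the normalizing weights cancel.  At time 1 all free
   particles are coupled, and the mean of [phi] is the normalizing constant. *)
Require Import Defs.
From mathcomp Require Import all_boot all_order all_algebra.
From mathcomp Require Import all_classical all_reals all_analysis.
From mathcomp Require Import measurable_realfun lra ring.

Set Implicit Arguments.
Unset Strict Implicit.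
Unset Printing Implicit Defensive.
Import Order.TTheory GRing.Theory Num.Theory.
Local Open Scope classical_set_scope.
Local Open Scope ring_scope.

(** * Integration against composed kernels *)

Section integration.
Local Open Scope ereal_scope.

(* The library's [ge0_le_integral] also requires measurability. *)
Lemma le_integral_nonneg d (Y : measurableType d) (R : realType)
    (nu : {measure set Y -> \bar R}) (f g : Y -> \bar R) :
  (forall y, 0 <= f y) -> (forall y, f y <= g y) ->
  \int[nu]_y f y <= \int[nu]_y g y.
Proof.
move=> f0 fg; have g0 y : 0 <= g y by exact: le_trans (fg y).
rewrite !ge0_integralTE//; apply: le_ereal_sup => _ [h /= hf <-].
by exists h => //= y; exact: le_trans (fg y).
Qed.

Section kernels.
Context d d' (H : measurableType d) (Y : measurableType d') (R : realType).

Lemma integral_kret (f : H -> Y) (mf : measurable_fun setT f) (h : H)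
    (phi : Y -> \bar R) : measurable_fun setT phi ->
  \int[kret (R := R) mf h]_y phi y = phi (f h).
Proof.
move=> mphi; rewrite (_ : kret (R := R) mf h = \d_(f h))//.
by rewrite integral_dirac// diracT mul1e.
Qed.

Lemma integral_kbind d'' (Z : measurableType d'') (l : R.-pker H ~> Y)
    (k : R.-pker (H * Y) ~> Z) (h : H) (phi : Z -> \bar R) :
  (forall z, 0 <= phi z) -> measurable_fun setT phi ->
  \int[kbind l k h]_z phi z = \int[l h]_y \int[k (h, y)]_z phi z.
Proof. by move=> phi0 mphi; rewrite -(integral_kcomp l k h phi0 mphi). Qed.

Lemma integral_kcomap d'' (H' : measurableType d'') (f : H' -> H)
    (mf : measurable_fun setT f) (k : R.-pker H ~> Y) (h : H')
    (phi : Y -> \bar R) :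
  \int[kcomap mf k h]_y phi y = \int[k (f h)]_y phi y.
Proof. by []. Qed.

End kernels.

Section derived_kernels.
Context d d' (H : measurableType d) (Y : measurableType d') (R : realType).

Lemma integral_kmap d'' (Z : measurableType d'') (l : R.-pker H ~> Y)
    (f : H * Y -> Z) (mf : measurable_fun setT f) (h : H) (phi : Z -> \bar R) :
  (forall z, 0 <= phi z) -> measurable_fun setT phi ->
  \int[kbind l (kret mf) h]_z phi z = \int[l h]_y phi (f (h, y)).
Proof.
move=> phi0 mphi; rewrite integral_kbind//.
by apply: eq_integral => y _; rewrite integral_kret.
Qed.

End derived_kernels.

(** * Kernels with densities, and sums over independent draws *)

Section density_and_iid.
Context d d' (H : measurableType d) (Y : measurableType d') (R : realType).

Lemma kite_true (A : set H) (mA : measurable A) (k1 k2 : R.-pker H ~> Y) h :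
  A h -> kite mA k1 k2 h = k1 h :> {measure set Y -> \bar R}.
Proof. by move=> Ah; rewrite /kite/= /mkker mem_set. Qed.

Section density.
Import HBNNSimple.
Variables (nu : {sigma_finite_measure set Y -> \bar R}) (f : H -> Y -> R).
Hypotheses (mf : measurable_fun setT (fun p : H * Y => f p.1 p.2))
  (f_ge0 : forall h y, (0 <= f h y)%R)
  (f1 : forall h, \int[nu]_y (f h y)%:E = 1).

Let mfh h : measurable_fun setT (fun y => (f h y)%:E).
Proof.
by apply/measurable_EFinP; exact: (measurableT_comp mf (pair1_measurable h)).
Qed.

Let integral_kdensity_nnsfun h (g : {nnsfun Y >-> R}) :
  \int[kdensity mf f_ge0 f1 h]_y (g y)%:E = \int[nu]_y ((f h y)%:E * (g y)%:E).
Proof.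
under [in LHS]eq_integral do rewrite fimfunE -fsumEFin//.
rewrite ge0_integral_fsum//; last 2 first.
  - by move=> r; exact/measurable_EFinP/measurableT_comp.
  - by move=> r z _; rewrite EFinM nnfun_muleindic_ge0.
under [in RHS]eq_integral.
  move=> y _; rewrite fimfunE -fsumEFin// ge0_mule_fsumr; last first.
    by move=> r; rewrite EFinM nnfun_muleindic_ge0.
  over.
rewrite ge0_integral_fsum//; last 2 first.
  - move=> r; apply: emeasurable_funM => //.
    by apply/measurable_EFinP; exact: measurableT_comp.
  - by move=> r z _; rewrite mule_ge0 ?lee_fin//; have := nnfun_muleindic_ge0 g r z.
apply: eq_fsbigr => r _.
(* A negative [r] is not a value of [g], so both integrands vanish; a nonnegative [r] can be taken
   out of the integrals. *)
have [r0|r0] := leP 0%R r; last first.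
  rewrite integral0_eq; last first.
    by move=> y _; rewrite preimage_nnfun0// indic0 mulr0.
  rewrite integral0_eq// => y _.
  by rewrite preimage_nnfun0// indic0 mulr0 mule0.
under [in LHS]eq_integral do rewrite EFinM.
rewrite ge0_integralZl//; last exact/measurable_EFinP.
rewrite integral_indic// setIT.
rewrite (_ : kdensity mf f_ge0 f1 h _ =
  \int[nu]_(y in g @^-1` [set r]) (f h y)%:E)//.
under [in RHS]eq_integral do rewrite EFinM muleCA.
rewrite ge0_integralZl//; last 2 first.
- by apply: emeasurable_funM => //; exact/measurable_EFinP.
- by move=> y _; rewrite mule_ge0// lee_fin.
by rewrite [in LHS]integral_mkcond epatch_indic.
Qed.

(** Monotone convergence on both sides, along simple functions increasing to [phi]. *)
Lemma integral_kdensity h (phi : Y -> \bar R) :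
  (forall y, 0 <= phi y) -> measurable_fun setT phi ->
  \int[kdensity mf f_ge0 f1 h]_y phi y = \int[nu]_y ((f h y)%:E * phi y).
Proof.
move=> phi0 mphi; pose g := nnsfun_approx measurableT mphi.
have gphi y : EFin \o g ^~ y @ \oo --> phi y.
  exact: cvg_nnsfun_approx.
have mg n : measurable_fun setT (fun y => (g n y)%:E) by exact/measurable_EFinP.
have ndg y : {homo (fun n => (g n y)%:E) : a b / (a <= b)%N >-> a <= b}.
  by move=> a b ab; rewrite lee_fin; exact/lefP/nd_nnsfun_approx.
transitivity (\int[kdensity mf f_ge0 f1 h]_y limn (EFin \o g ^~ y)).
  by apply: eq_integral => y _; apply/esym/cvg_lim => //; exact: gphi.
rewrite monotone_convergence//; last by move=> n y _; rewrite lee_fin.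
under eq_fun do rewrite integral_kdensity_nnsfun.
rewrite -monotone_convergence//.
- apply: eq_integral => y _; apply: cvg_lim => //.
  by apply: cvgeZl => //; exact: gphi.
- by move=> n; apply: emeasurable_funM.
- by move=> n y _; rewrite mule_ge0 ?lee_fin.
- by move=> y _ a b ab; rewrite lee_wpmul2l ?lee_fin//; exact: ndg.
Qed.

End density.

Section iid.
Variable k : R.-pker H ~> Y.

Lemma integral_kiidS n h (phi : n.+1.-tuple Y -> \bar R) :
  (forall s, 0 <= phi s) -> measurable_fun setT phi ->
  \int[kiid k n.+1 h]_s phi s =
  \int[k h]_y \int[kiid k n h]_s phi [tuple of y :: s].
Proof.
(* The measurability proof inside [kiid] has no name outside its section; an existential statement
   proved by [reflexivity] recovers it. The same device unfolds other kernels below. *)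
have [mcons ->] : exists mcons, kiid k n.+1 =
    kbind k (kbind (kcomap measurable_fst (kiid k n))
      (kret (f := fun p : H * Y * n.-tuple Y =>
        [the n.+1.-tuple Y of p.1.2 :: p.2]) mcons)) by eexists; reflexivity.
move=> phi0 mphi; rewrite integral_kbind//; apply: eq_integral => y _.
by rewrite integral_kmap.
Qed.

Lemma measurable_sum_tnth n (F : Y -> R) : measurable_fun setT F ->
  measurable_fun setT (fun s : n.-tuple Y => (\sum_(i < n) F (tnth s i))%R).
Proof.
move=> mF; apply: measurable_sum => i.
exact: (measurableT_comp mF (measurable_tnth i)).
Qed.

Lemma sum_tnth_cons n (F : Y -> R) y (s : n.-tuple Y) :
  (\sum_(i < n.+1) F (tnth [tuple of y :: s] i) =
   F y + \sum_(i < n) F (tnth s i))%R.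
Proof.
by rewrite big_ord_recl tnth0; congr +%R; apply: eq_bigr => i _; rewrite tnthS.
Qed.

Variables (h : H) (F G : Y -> R) (u w : R).
Hypotheses (mF : measurable_fun setT F) (mG : measurable_fun setT G).
Hypotheses (F_ge0 : forall y, (0 <= F y)%R) (G_ge0 : forall y, (0 <= G y)%R).
Hypotheses (intF : \int[k h]_y (F y)%:E = u%:E)
  (intG : \int[k h]_y (G y)%:E = w%:E).

Let sum_ge0 n (E : Y -> R) (s : n.-tuple Y) : (forall y, 0 <= E y)%R ->
  (0 <= \sum_(i < n) E (tnth s i))%R.
Proof. by move=> E0; apply: sumr_ge0. Qed.

Lemma integral_kiid_sum n (E : Y -> R) e : measurable_fun setT E ->
  (forall y, 0 <= E y)%R -> \int[k h]_y (E y)%:E = e%:E ->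
  \int[kiid k n h]_s (\sum_(i < n) E (tnth s i))%:E = (n%:R * e)%:E.
Proof.
move=> mE E0 intE; elim: n => [|n IHn].
  by rewrite integral0_eq ?mul0r// => s _; rewrite big_ord0.
rewrite integral_kiidS; last 2 first.
- by move=> s; rewrite lee_fin; exact: sum_ge0.
- by apply/measurable_EFinP; exact: measurable_sum_tnth.
have inner y : \int[kiid k n h]_s
    (\sum_(i < n.+1) E (tnth [tuple of y :: s] i))%:E =
    (E y)%:E + (n%:R * e)%:E.
  under eq_integral do rewrite sum_tnth_cons EFinD.
  rewrite ge0_integralD//.
  - by rewrite IHn integral_cst// prob_kernel mule1.
  - by move=> s _; rewrite lee_fin.
  - by move=> s _; rewrite lee_fin; exact: sum_ge0.
  - by apply/measurable_EFinP; exact: measurable_sum_tnth.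
under eq_integral do rewrite inner.
rewrite ge0_integralD//.
- by rewrite intE integral_cst// prob_kernel mule1 -EFinD -natr1 mulrDl mul1r addrC.
- by move=> y _; rewrite lee_fin.
- exact/measurable_EFinP.
- by move=> y _; rewrite -IHn; apply: integral_ge0 => s _; rewrite lee_fin sum_ge0.
Qed.

(** By independence the [n (n - 1)] products at distinct draws have mean [u * w] each, and the [n]
    products at a single draw have mean at most [D * u]. *)
Lemma integral_kiid_sumM n (D : R) : (forall y, G y <= D)%R ->
  \int[kiid k n h]_s
     ((\sum_(i < n) F (tnth s i)) * (\sum_(i < n) G (tnth s i)))%:E <=
  (n%:R * (D * u) + n%:R * (n%:R - 1) * (u * w))%:E.
Proof.
move=> GD; elim: n => [|n IHn].
  rewrite integral0_eq ?mul0r ?addr0// => s _.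
  by rewrite big_ord0 mul0r.
have D0 : (0 <= D)%R by apply: le_trans (GD point).
have mS (E : Y -> R) : measurable_fun setT E ->
    measurable_fun setT (fun s : n.-tuple Y => (\sum_(i < n) E (tnth s i))%:E).
  by move=> mE; apply/measurable_EFinP; exact: measurable_sum_tnth.
have S0 (E : Y -> R) (s : n.-tuple Y) : (forall y, 0 <= E y)%R ->
    0 <= (\sum_(i < n) E (tnth s i))%:E.
  by move=> E0; rewrite lee_fin sum_ge0.
have mFG : measurable_fun setT (fun s : n.-tuple Y =>
    (\sum_(i < n) F (tnth s i))%:E * (\sum_(i < n) G (tnth s i))%:E).
  by apply: emeasurable_funM; exact: mS.
rewrite integral_kiidS; last 2 first.
- by move=> s; rewrite lee_fin mulr_ge0 ?sum_ge0.
- by apply/measurable_EFinP; apply: measurable_funM; exact: measurable_sum_tnth.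
have w0 : (0 <= w)%R.
  by rewrite -lee_fin -intG; apply: integral_ge0 => y _; rewrite lee_fin.
have u0 : (0 <= u)%R.
  by rewrite -lee_fin -intF; apply: integral_ge0 => y _; rewrite lee_fin.
pose r := (n%:R * (D * u) + n%:R * (n%:R - 1) * (u * w))%R.
have r0 : (0 <= r)%R.
  rewrite -lee_fin (le_trans _ IHn)//; apply: integral_ge0 => s _.
  by rewrite lee_fin mulr_ge0 ?sum_ge0.
(* With the first draw [y] split off, [c1] bounds the coefficient of [F y] ([D] for [G y], plus the
   mean of the other [G]), [c2] is that of [G y], and [r] is the induction bound. *)
pose c1 := (D + n%:R * w)%R; pose c2 := (n%:R * u)%R.
have c10 : (0 <= c1)%R by rewrite addr_ge0 ?mulr_ge0.
have c20 : (0 <= c2)%R by rewrite mulr_ge0.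
apply: (@le_trans _ _ (\int[k h]_y (c1%:E * (F y)%:E + c2%:E * (G y)%:E + r%:E))).
  apply: le_integral_nonneg => y.
    by apply: integral_ge0 => s _; rewrite lee_fin mulr_ge0 ?sum_ge0.
  under eq_integral.
    move=> s _; rewrite !sum_tnth_cons.
    rewrite [X in X%:E](_ : _ = F y * G y +
        F y * (\sum_(i < n) G (tnth s i)) +
        G y * (\sum_(i < n) F (tnth s i)) +
        (\sum_(i < n) F (tnth s i)) * (\sum_(i < n) G (tnth s i)))%R; last first.
      by ring.
    rewrite !EFinD !EFinM; over.
  have Fy0 : 0 <= (F y)%:E by rewrite lee_fin.
  have Gy0 : 0 <= (G y)%:E by rewrite lee_fin.
  have mFS : measurable_fun setT (fun s : n.-tuple Y =>
      (F y)%:E * (\sum_(i < n) G (tnth s i))%:E).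
    by apply: emeasurable_funM => //; exact: mS.
  have mGS : measurable_fun setT (fun s : n.-tuple Y =>
      (G y)%:E * (\sum_(i < n) F (tnth s i))%:E).
    by apply: emeasurable_funM => //; exact: mS.
  rewrite ge0_integralD//; last 3 first.
  - by move=> s _; rewrite !adde_ge0 ?mule_ge0// S0.
  - by apply: emeasurable_funD => //; exact: emeasurable_funD.
  - by move=> s _; rewrite mule_ge0 ?S0.
  apply: leeD; last by under eq_integral do rewrite -EFinM.
  rewrite ge0_integralD//; last 3 first.
  - by move=> s _; rewrite !adde_ge0 ?mule_ge0// S0.
  - exact: emeasurable_funD.
  - by move=> s _; rewrite mule_ge0 ?S0.
  rewrite [X in _ + X <= _]ge0_integralZl//; [|exact: mS|by move=> s _; exact: S0].
  rewrite (integral_kiid_sum _ mF F_ge0 intF) -/c2 [X in _ <= _ + X]muleC.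
  apply: leeD => //.
  rewrite ge0_integralD//; last 2 first.
  - by move=> s _; rewrite mule_ge0.
  - by move=> s _; rewrite mule_ge0 ?S0.
  rewrite [X in _ + X <= _]ge0_integralZl//; [|exact: mS|by move=> s _; exact: S0].
  rewrite (integral_kiid_sum _ mG G_ge0 intG) integral_cst// prob_kernel mule1.
  rewrite -!EFinM -EFinD lee_fin /c1 mulrDl (mulrC (F y) (G y)).
  by rewrite lerD ?(mulrC (F y))// ler_wpM2r.
have mcE (c : R) (E : Y -> R) : measurable_fun setT E ->
    measurable_fun setT (fun y : Y => c%:E * (E y)%:E).
  by move=> mE; apply: emeasurable_funM => //; exact/measurable_EFinP.
rewrite ge0_integralD//; last 2 first.
- by move=> y _; rewrite adde_ge0 ?mule_ge0 ?lee_fin.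
- by apply: emeasurable_funD; exact: mcE.
rewrite ge0_integralD//; [|by move=> y _; rewrite mule_ge0 ?lee_fin|exact: mcE
  |by move=> y _; rewrite mule_ge0 ?lee_fin|exact: mcE].
rewrite !ge0_integralZl_EFin//; [|by move=> y _; rewrite lee_fin
  |exact/measurable_EFinP|by move=> y _; rewrite lee_fin|exact/measurable_EFinP].
rewrite intF intG integral_cst// prob_kernel mule1 -!EFinM -!EFinD lee_fin.
by rewrite /c1 /c2 /r -[n.+1%:R]natr1; lra.
Qed.

(* The tangent bound [1 / x >= 2 / m - x / m ^+ 2] at the mean [m] replaces
   Jensen's inequality, and [D] pays for the dependence between [F] and [G]
   evaluated at the same draw. *)
Lemma integral_kiid_ratio n (D a : R) : (forall y, G y <= D)%R -> (0 < a)%R ->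
  (n%:R * u / (a + D + (n%:R - 1) * w))%:E <=
  \int[kiid k n h]_s ((\sum_(i < n) F (tnth s i)) /
                      (a + \sum_(i < n) G (tnth s i)))%:E.
Proof.
move=> GD a0.
case: n => [|n].
  by rewrite !mul0r; apply: integral_ge0 => s _; rewrite big_ord0 mul0r.
have D0 : (0 <= D)%R by apply: le_trans (GD point).
have w0 : (0 <= w)%R.
  by rewrite -lee_fin -intG; apply: integral_ge0 => y _; rewrite lee_fin.
have u0 : (0 <= u)%R.
  by rewrite -lee_fin -intF; apply: integral_ge0 => y _; rewrite lee_fin.
set m := (_ + _ + _ * w)%R.
have m0 : (0 < m)%R.
  rewrite /m -natr1 addrK ltr_wpDr ?mulr_ge0// ltr_wpDr//.
pose SF (s : n.+1.-tuple Y) := (\sum_(i < n.+1) F (tnth s i))%R.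
pose SG (s : n.+1.-tuple Y) := (\sum_(i < n.+1) G (tnth s i))%R.
have SF0 s : (0 <= SF s)%R by exact: sum_ge0.
have SG0 s : (0 <= SG s)%R by exact: sum_ge0.
have mSF : measurable_fun setT SF by exact: measurable_sum_tnth.
have mSG : measurable_fun setT SG by exact: measurable_sum_tnth.
have mSFG : measurable_fun setT (fun s => (SF s * SG s)%:E).
  by apply/measurable_EFinP; exact: measurable_funM.
have maSF (b : R) : measurable_fun setT (fun s => b%:E * (SF s)%:E).
  by apply: emeasurable_funM => //; exact/measurable_EFinP.
have mratio : measurable_fun setT (fun s => (SF s / (a + SG s))%:E).
  apply/measurable_EFinP; apply: measurable_funM => //.
  apply: (measurableT_comp (@measurable_invr R)).
  exact: measurable_funD.
have mquad : measurable_fun setT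
    (fun s => a%:E * (SF s)%:E + (SF s * SG s)%:E).
  exact: emeasurable_funD.
(* The difference of the two sides is [SF s] times a square over a positive number. *)
have tangent s : (2 / m)%:E * (SF s)%:E <= (SF s / (a + SG s))%:E +
    (m ^- 2)%:E * (a%:E * (SF s)%:E + (SF s * SG s)%:E).
  rewrite -!EFinM -!EFinD lee_fin.
  have x0 : (0 < a + SG s)%R by rewrite ltr_wpDr.
  rewrite (mulrC a) -mulrDr -subr_ge0.
  have mx : (m != 0)%R && (a + SG s != 0)%R by rewrite !gt_eqF.
  rewrite [leRHS](_ : _ =
      SF s * ((m - (a + SG s)) ^+ 2 / ((a + SG s) * m ^+ 2)))%R; last by field.
  by rewrite mulr_ge0// divr_ge0 ?sqr_ge0// mulr_ge0 ?sqr_ge0// ltW.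
have intSF : \int[kiid k n.+1 h]_s (SF s)%:E = (n.+1%:R * u)%:E.
  exact: integral_kiid_sum.
have SFE0 s : [set: n.+1.-tuple Y] s -> 0 <= (SF s)%:E by rewrite lee_fin.
have mSFE : measurable_fun setT (fun s => (SF s)%:E) by exact/measurable_EFinP.
have quad0 s : 0 <= a%:E * (SF s)%:E + (SF s * SG s)%:E.
  by rewrite -EFinM -EFinD lee_fin addr_ge0 ?mulr_ge0// ltW.
have ratio0 s : 0 <= (SF s / (a + SG s))%:E.
  by rewrite lee_fin divr_ge0 ?addr_ge0// ltW.
have intSFG := integral_kiid_sumM n.+1 GD.
pose e := \int[kiid k n.+1 h]_s (SF s / (a + SG s))%:E.
rewrite -[leRHS]/e.
have : (2 / m * (n.+1%:R * u))%:E <= e + (n.+1%:R * u / m)%:E.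
  rewrite EFinM -intSF -ge0_integralZl_EFin//; last by rewrite divr_ge0// ltW.
  apply: (le_trans (le_integral_nonneg (kiid k n.+1 h) _ tangent)) => [s|].
    by rewrite mule_ge0 ?lee_fin// divr_ge0// ltW.
  have im0 : (0 <= m ^- 2)%R by rewrite invr_ge0 sqr_ge0.
  rewrite ge0_integralD//; last 2 first.
  - by move=> s _; rewrite mule_ge0.
  - exact: emeasurable_funM.
  rewrite ge0_integralZl_EFin// leeD2l//.
  rewrite ge0_integralD//; last 2 first.
  - by move=> s _; rewrite mule_ge0 ?lee_fin// ltW.
  - by move=> s _; rewrite lee_fin mulr_ge0.
  rewrite ge0_integralZl_EFin ?(ltW a0)// intSF.
  apply: (@le_trans _ _ ((m ^- 2)%:E * (a%:E * (n.+1%:R * u)%:E +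
    (n.+1%:R * (D * u) + n.+1%:R * (n.+1%:R - 1) * (u * w))%:E))).
    by rewrite lee_wpmul2l ?lee_fin// leeD2l.
  rewrite -EFinM lee_fin.
  (* The value of [m] is the one that makes the three terms add up to [n.+1 * u * m], so that only
     one of the two copies of [n.+1 * u / m] is lost. *)
  rewrite [leLHS](_ : _ = m ^- 2 * (n.+1%:R * u * m))%R; last by rewrite /m; ring.
  rewrite le_eqVlt; apply/orP; left; apply/eqP; field.
  by rewrite gt_eqF.
have : 0 <= e by exact: integral_ge0.
(* An infinite integral satisfies the bound trivially; a finite one satisfies [2 q <= e + q], hence
   [q <= e]. *)
case: e => [e| |] //=; rewrite ?leey// => _; rewrite -EFinD !lee_fin.
rewrite (_ : 2 / m * (n.+1%:R * u) = 2 * (n.+1%:R * u / m))%R; last by ring.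
by move: (_ / m)%R => q; lra.
Qed.

End iid.
End density_and_iid.
End integration.

(** * Coupled resampling: the mass of equal indices *)

Section coupled_resampling_bounds.
Variables (R : realType).

(** The common part alone contributes the minimum, and the residual part only adds mass. *)
Lemma cres_pmf_diag_ge n (w w' : 'I_n -> R) j :
  (forall i, 0 <= w i) -> (forall i, 0 <= w' i) -> \sum_i w i = 1 ->
  Num.min (w j) (w' j) <= cres_pmf w w' (j, j).
Proof.
move=> w0 w'0 w1.
have m0 i : 0 <= Num.min (w i) (w' i) by rewrite le_min w0 w'0.
have pc1 : 0 <= 1 - coupling_prob w w'.
  rewrite subr_ge0 -w1; apply: ler_sum => i _.
  by rewrite ge_min lexx.
rewrite /cres_pmf/= eqxx -[leLHS]addr0 lerD//; last first.
  by rewrite mulr_ge0// mulr_ge0// divr_ge0// subr_ge0 ge_min lexx ?orbT.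
(* If the coupling probability is 0, the quotient cannot be cancelled, but every minimum is 0. *)
rewrite /common_part; have [pc0|pc0] := eqVneq (coupling_prob w w') 0.
  rewrite pc0 mul0r; have := psumr_eq0P (fun i _ => m0 i) pc0.
  by move=> /(_ j isT) ->.
by rewrite mulrCA divff// mulr1.
Qed.

(** Replacing either total by the larger one only lowers the quotient. If a total is 0, all its
    weights are 0 and nonnegativity of [v] suffices. *)
Lemma le_min_normalized n (v : prob_vector R n) (w w' : 'I_n -> R) j :
  (forall i, 0 <= w i) -> (forall i, 0 <= w' i) -> w j = w' j ->
  w j / Num.max (\sum_i w i) (\sum_i w' i) <=
    Num.min (normalized v w j) (normalized v w' j).
Proof.
have half (u : 'I_n -> R) (V : R) : (forall i, 0 <= u i) -> \sum_i u i <= V ->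
    u j / V <= normalized v u j.
  move=> u0 uV; rewrite /normalized; have [s0|s0] := eqVneq (\sum_i u i) 0.
    have := psumr_eq0P (fun i _ => u0 i) s0 => /(_ j isT) ->.
    by rewrite mul0r pvec_ge0.
  have sp : 0 < \sum_i u i by rewrite lt_def s0 sumr_ge0.
  by rewrite ler_wpM2l// lef_pV2// posrE// (lt_le_trans sp).
move=> w0 w'0 wj; rewrite le_min half//=; last by rewrite le_max lexx.
by rewrite wj half// le_max lexx orbT.
Qed.

Local Open Scope ereal_scope.

(** Only the atoms [(j, j)] with [C j] are kept; the weights agree there, and the two preceding
    lemmas bound the mass of each atom. *)
Lemma le_integral_cres d (H : measurableType d) n (v : prob_vector R n.+1)
    (w w' : H -> 'I_n.+1 -> R)
    (mw : forall i, measurable_fun setT (w ^~ i))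
    (mw' : forall i, measurable_fun setT (w' ^~ i))
    (w_ge0 : forall h i, (0 <= w h i)%R) (w'_ge0 : forall h i, (0 <= w' h i)%R)
    (h : H) (C : pred 'I_n.+1) (phi : 'I_n.+1 * 'I_n.+1 -> \bar R) :
  (forall j, C j -> w h j = w' h j) -> (forall ij, 0 <= phi ij) ->
  \sum_(j | C j)
     (w h j / Num.max (\sum_i w h i) (\sum_i w' h i))%:E * phi (j, j) <=
  \int[cres v mw mw' w_ge0 w'_ge0 h]_ij phi ij.
Proof.
move=> ww' phi0; set V := Num.max _ _.
have mjj (j : 'I_n.+1) : measurable [set (j, j)].
  rewrite (_ : [set _] = [set j] `*` [set j]); first exact: measurableX.
  by apply/seteqP; split => [[a b] [-> ->]//|[a b] /= [-> ->]].
apply: (@le_trans _ _ (\int[cres v mw mw' w_ge0 w'_ge0 h]_ij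
    (\sum_(j | C j) phi (j, j) * (\1_[set (j, j)] ij)%:E))); last first.
  apply: le_integral_nonneg => ij.
    by apply: sume_ge0 => j _; rewrite mule_ge0// lee_fin.
  have [[Ci ij_eq]|Nij] := pselect (C ij.1 /\ ij.1 = ij.2).
    case: ij Ci ij_eq => a b /= Ca <-; rewrite (bigD1 a)//= big1 ?adde0.
      by rewrite -[leRHS]mule1 lee_wpmul2l// lee_fin indicE; case: (_ \in _).
    move=> j /andP[_ ja]; rewrite indicE memNset ?mule0//= => -[aj].
    by rewrite aj eqxx in ja.
  rewrite big1// => j Cj; rewrite indicE memNset ?mule0//=.
  by move=> ijE; apply: Nij; rewrite ijE.
under eq_integral do rewrite -big_filter.
rewrite ge0_integral_sum//; last 2 first.
- by move=> j; apply: measurable_funeM; exact/measurable_EFinP.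
- by move=> j ij _; rewrite mule_ge0// lee_fin.
rewrite big_filter; apply: lee_sum => j Cj.
rewrite ge0_integralZl//; last exact/measurable_EFinP.
rewrite integral_indic// setIT muleC lee_wpmul2l//.
pose p := cres_pmf (normalized v (w h)) (normalized v (w' h)).
have p_ge0 i : (0 <= p i)%R.
  by apply: cres_pmf_ge0; rewrite ?normalized_sum1// => i'; exact: normalized_ge0.
rewrite (_ : cres v mw mw' w_ge0 w'_ge0 h [set (j, j)] =
  \sum_ij (p ij)%:E * \d_ij [set (j, j)])//.
rewrite (bigD1 (j, j))//= diracE mem_set// mule1 -[leLHS]adde0 leeD//; last first.
  by apply: sume_ge0 => i _; rewrite mule_ge0 ?lee_fin.
rewrite lee_fin; apply: (@le_trans _ _ (Num.min (normalized v (w h) j)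
    (normalized v (w' h) j))).
  by apply: le_min_normalized => //; exact: ww'.
by apply: cres_pmf_diag_ge; rewrite ?normalized_sum1// => i; exact: normalized_ge0.
Qed.

End coupled_resampling_bounds.

(** * One generation of the coupled filter *)

Section particle_filter.
Context d (X : measurableType d) (R : realType).
Variable mu : {sigma_finite_measure set X -> \bar R}.
Variable m : model mu.
Hypothesis mdiag : measurable [set p : X * X | p.1 = p.2].
Variable K : nat -> R.-pker (X * X) ~> (X * X)%type.
Variables (n : nat) (v : prob_vector R n.+1).

Local Notation particle := ('I_n.+1 * X)%type.
Local Notation particle_pair := (particle * particle)%type.
Local Notation generation := (n.+1.-tuple particle_pair).
Local Notation history t := (t.-tuple generation).

Local Open Scope ereal_scope.

(** On the diagonal [mutate] draws one state and duplicates it. *)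
Lemma integral_mutate_diag t x (psi : X * X -> \bar R) :
  (forall p, 0 <= psi p) -> measurable_fun setT psi ->
  \int[mutate m mdiag K t (x, x)]_p psi p =
  \int[trans_kernel m t x]_y psi (y, y).
Proof.
have [mdup ->] : exists mdup, mutate m mdiag K t =
  kite mdiag (kbind (kcomap measurable_fst (trans_kernel m t))
    (kret (f := fun p : X * X * X => (p.2, p.2)) mdup)) (K t).
  by eexists; reflexivity.
move=> psi0 mpsi.
have -> : kite mdiag (kbind (kcomap measurable_fst (trans_kernel m t))
    (kret (f := fun p : X * X * X => (p.2, p.2)) mdup)) (K t) (x, x) =
  kbind (kcomap measurable_fst (trans_kernel m t))
    (kret (f := fun p : X * X * X => (p.2, p.2)) mdup) (x, x)
    :> {measure set (X * X) -> \bar R} by rewrite kite_true.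
by rewrite integral_kmap.
Qed.

Lemma le_integral_resample t (g : generation) (C : pred 'I_n.+1)
    (phi : 'I_n.+1 * 'I_n.+1 -> \bar R) :
  (forall j, C j -> (tnth g j).1.2 = (tnth g j).2.2) ->
  (forall ij, 0 <= phi ij) ->
  \sum_(j | C j) (weight m fst t g j /
      Num.max (\sum_i weight m fst t g i) (\sum_i weight m snd t g i))%:E *
    phi (j, j) <=
  \int[resample m v t g]_ij phi ij.
Proof.
by move=> Cpos phi0; apply: le_integral_cres => // j Cj; rewrite /weight Cpos.
Qed.

(** The bound keeps only the event that both sides select the same ancestor [j] with [C j]. The two
    parents then have equal positions, so the children coincide as well. *)
Lemma le_integral_next_pair t (g : generation) (C : pred 'I_n.+1)
    (F : particle_pair -> \bar R) (phi : X -> \bar R) :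
  (forall p, 0 <= F p) -> measurable_fun setT F ->
  (forall j, C j -> (tnth g j).1.2 = (tnth g j).2.2) ->
  (forall j x, C j -> F ((j, x), (j, x)) = phi x) ->
  \sum_(j | C j) (weight m fst t g j /
      Num.max (\sum_i weight m fst t g i) (\sum_i weight m snd t g i))%:E *
    (\int[trans_kernel m t.+1 (tnth g j).1.2]_x phi x) <=
  \int[next_pair m mdiag K v t.+1 g]_p F p.
Proof.
move=> F0 mF Cpos Fphi.
have [msel [matt ->]] : exists msel matt, next_pair m mdiag K v t.+1 =
    kbind (resample m v t) (kbind
     (kcomap (f := fun p : generation * ('I_n.+1 * 'I_n.+1) =>
        ((tnth p.1 p.2.1).1.2, (tnth p.1 p.2.2).2.2)) msel
        (mutate m mdiag K t.+1))
     (kret (f := fun p : generation * ('I_n.+1 * 'I_n.+1) * (X * X) =>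
        ((p.1.2.1, p.2.1), (p.1.2.2, p.2.2)) : particle_pair) matt)).
  by eexists; eexists; reflexivity.
rewrite integral_kbind//.
under eq_integral do rewrite integral_kmap// integral_kcomap.
set phi' := (X in \int[_]_ij X ij).
have phi'0 ij : 0 <= phi' ij by exact: integral_ge0.
apply: (le_trans _ (le_integral_resample t Cpos phi'0)).
apply: lee_sum => j Cj; rewrite lee_wpmul2l//.
  rewrite lee_fin divr_ge0// ?potential_ge0// le_max sumr_ge0// => i _.
  exact: potential_ge0.
rewrite /phi'/= -(Cpos j Cj) integral_mutate_diag//.
  by under [leRHS]eq_integral do rewrite Fphi//.
apply: (measurableT_comp mF).
by apply: measurable_fun_pair; exact: measurable_fun_pair.
Qed.

(** The tower property for the last generation; it lets a bound on a conditional mean be integrated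
    over the past. *)
Lemma integral_history_law T (sref sref' : T.-tuple X) t
    (f : history t.+1 -> \bar R) :
  (forall h, 0 <= f h) -> measurable_fun setT f ->
  \int[history_law m mdiag K v sref sref' t.+1 tt]_h f h =
  \int[history_law m mdiag K v sref sref' t tt]_h
    \int[free_pairs m mdiag K v t h]_p
      f [tuple of [tuple of reference_pair n sref sref' t.+1 :: p] :: h].
Proof.
have [mrec ->] : exists mrec, history_law m mdiag K v sref sref' t.+1 =
    kbind (history_law m mdiag K v sref sref' t)
      (kbind (kcomap measurable_snd (free_pairs m mdiag K v t))
        (kret (f := fun p : unit * history t * n.-tuple particle_pair =>
          [the history t.+1 of
            [the generation of reference_pair n sref sref' t.+1 :: p.2] :: p.1.2])
        mrec)) by eexists; reflexivity.
move=> f0 mf; rewrite integral_kbind//; apply: eq_integral => h _.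
by rewrite integral_kmap.
Qed.


End particle_filter.

(** * Coupled particles and their score *)

Section coupled_particles.
Context d (X : measurableType d) (R : realType).
Hypothesis mdiag : measurable [set p : X * X | p.1 = p.2].
Variable n : nat.

Local Notation particle := ('I_n.+1 * X)%type.
Local Notation particle_pair := (particle * particle)%type.
Local Notation generation := (n.+1.-tuple particle_pair).
Local Notation history t := (t.-tuple generation).

(** A finite intersection of preimages of the diagonal of [X], one for each coordinate. *)
Lemma measurable_eq_tuple t :
  measurable [set p : t.-tuple X * t.-tuple X | p.1 = p.2].
Proof using mdiag.
rewrite (_ : [set p | _] = \big[setI/setT]_(i < t)
    [set p : t.-tuple X * t.-tuple X | tnth p.1 i = tnth p.2 i]).
  apply: bigsetI_measurable => i _; rewrite -[X in measurable X]setTI.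
  pose f (p : t.-tuple X * t.-tuple X) := (tnth p.1 i, tnth p.2 i).
  have mf : measurable_fun setT f.
    by apply: measurable_fun_pair;
      apply: (measurableT_comp (measurable_tnth i)).
  exact: (mf measurableT _ mdiag).
apply/seteqP; split => [[p q] /= ->|[p q] pq] /=.
  by elim/big_ind : _ => //= A B Ap Bp; split.
apply: eq_from_tnth => i; move: pq; rewrite (bigD1 i)//= => -[].
by [].
Qed.

Lemma measurable_eqb_tuple d' (H : measurableType d') t (f g : H -> t.-tuple X) :
  measurable_fun setT f -> measurable_fun setT g ->
  measurable_fun setT (fun h => `[< f h = g h >]).
Proof using mdiag.
move=> mf mg; apply: (measurable_fun_bool true).
rewrite (_ : _ @^-1` _ = (fun h => (f h, g h)) @^-1` [set p | p.1 = p.2]).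
  have mfg : measurable_fun setT (fun h => (f h, g h)).
    exact: measurable_fun_pair.
  exact: (mfg measurableT _ (@measurable_eq_tuple t)).
by apply/seteqP; split => h /= /asboolP.
Qed.

Lemma measurable_ancestral_path side t : measurable_fun setT side ->
  measurable_fun setT
    (fun p : history t * 'I_n.+1 => ancestral_path side p.1 p.2).
Proof.
move=> mside; elim: t => [|t IHt] /=; first exact: measurable_cst.
apply: measurable_discr => j /=.
have mp : measurable_fun setT (fun h : history t.+1 => side (tnth (thead h) j)).
  apply: (measurableT_comp mside).
  apply: (measurableT_comp (measurable_tnth j)); exact: measurable_tnth.
apply: measurable_rcons; first exact: (measurableT_comp measurable_snd mp).
apply: (measurableT_comp IHt (g := fun h : history t.+1 =>
  ([tuple of behead h] : history t, (side (tnth (thead h) j)).1))).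
apply: measurable_fun_pair; first exact: measurable_behead.
exact: (measurableT_comp measurable_fst mp).
Qed.

(** Whole paths are compared, since the outputs must agree at all times. Excluding [ord0], even for
    equal reference paths, keeps [uncoupled] at least 1. *)
Definition coupled t (h : history t) (i : 'I_n.+1) : bool :=
  (i != ord0) && `[< ancestral_path fst h i = ancestral_path snd h i >].

Lemma coupled_pos t (h : history t.+1) i : coupled h i ->
  (tnth (thead h) i).1.2 = (tnth (thead h) i).2.2.
Proof.
by move=> /andP[_ /asboolP /= /(congr1 val)/= /rcons_inj[]].
Qed.

Lemma measurable_coupled t i :
  measurable_fun setT (fun h : history t => coupled h i).
Proof using mdiag.
apply: measurable_and => //.
by apply: measurable_eqb_tuple;
  apply: (measurableT_comp (measurable_ancestral_path _) (pair2_measurable i)).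
Qed.

Definition coupled_sum t (phi : X -> R) (h : history t.+1) : R :=
  \sum_(i | coupled h i) phi (tnth (thead h) i).1.2.

Definition uncoupled t (h : history t) : R := \sum_(i | ~~ coupled h i) 1.

Definition score t (phi : X -> R) (a : R) (h : history t.+1) : R :=
  coupled_sum phi h / (coupled_sum phi h + a * uncoupled h).

Lemma uncoupled_ge1 t (h : history t) : 1 <= uncoupled h.
Proof. by rewrite /uncoupled (bigD1 ord0)//= lerDl sumr_ge0. Qed.

Lemma coupled_sum_ge0 t (phi : X -> R) (h : history t.+1) :
  (forall x, 0 <= phi x) -> 0 <= coupled_sum phi h.
Proof. by move=> phi0; apply: sumr_ge0. Qed.

Lemma score_ge0 t (phi : X -> R) (a : R) (h : history t.+1) :
  (forall x, 0 <= phi x) -> 0 <= a -> 0 <= score phi a h.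
Proof.
move=> phi0 a0; have U1 := uncoupled_ge1 h.
by rewrite divr_ge0 ?addr_ge0 ?mulr_ge0 ?coupled_sum_ge0// (le_trans _ U1).
Qed.

Lemma measurable_score t (phi : X -> R) (a : R) : measurable_fun setT phi ->
  measurable_fun setT (fun h : history t.+1 => score phi a h).
Proof using mdiag.
move=> mphi.
have mS : measurable_fun setT (fun h : history t.+1 => coupled_sum phi h).
  rewrite /coupled_sum; under eq_fun do rewrite big_mkcond.
  apply: measurable_sum => i; apply: measurable_fun_ifT => //.
    exact: measurable_coupled.
  apply: (measurableT_comp mphi); apply: (measurableT_comp measurable_snd).
  apply: (measurableT_comp measurable_fst).
  by apply: (measurableT_comp (measurable_tnth i)); exact: measurable_tnth.
have mU : measurable_fun setT (fun h : history t.+1 => uncoupled h).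
  rewrite /uncoupled; under eq_fun do rewrite big_mkcond.
  apply: measurable_sum => i; under eq_fun do rewrite if_neg.
  by apply: measurable_fun_ifT => //; exact: measurable_coupled.
apply: measurable_funM => //.
apply: (measurableT_comp (@measurable_invr R)).
by apply: measurable_funD => //; exact: measurable_funM.
Qed.

(** Tells whether a new free particle will be coupled, from its own pair and the past alone; this
    makes the next score a function of independent draws. *)
Definition extends t (h : history t) (q : particle_pair) : bool :=
  `[< [tuple of rcons (ancestral_path fst h q.1.1) q.1.2] =
      [tuple of rcons (ancestral_path snd h q.2.1) q.2.2] >].

Lemma measurable_extends t (h : history t) : measurable_fun setT (extends h).
Proof using mdiag.
have ms (side : particle_pair -> particle) (f : particle_pair -> particle) :
    measurable_fun setT side -> measurable_fun setT f ->
  measurable_fun setT (fun q : particle_pair =>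
    [tuple of rcons (ancestral_path side h (f q).1) (f q).2]).
  move=> mside mf.
  apply: measurable_rcons; first exact: (measurableT_comp measurable_snd).
  apply: (measurableT_comp (measurable_ancestral_path mside)
    (g := fun q => (h, (f q).1))).
  apply: measurable_fun_pair => //; exact: (measurableT_comp measurable_fst).
by apply: measurable_eqb_tuple; [exact: (ms fst fst)|exact: (ms snd snd)].
Qed.

Section next_generation.
Context t (h : history t) (r : particle_pair) (p : n.-tuple particle_pair).
Let h' : history t.+1 := [tuple of [tuple of r :: p] :: h].

Lemma coupled_ref : coupled h' ord0 = false.
Proof. by rewrite /coupled eqxx. Qed.

Lemma coupled_next i : coupled h' (lift ord0 i) = extends h (tnth p i).
Proof.
have hh : [tuple of behead h'] = h by apply: val_inj.
by rewrite /coupled/= hh theadE tnthS.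
Qed.

(** The reference particle is never coupled and yields the isolated [a]; a free particle contributes
    [phi] to both sums if its two paths agree, and otherwise 0 and [a]. This is the shape that
    [integral_kiid_ratio] treats. *)
Lemma score_next (phi : X -> R) (a : R) : score phi a h' =
  (\sum_(i < n) if extends h (tnth p i) then phi (tnth p i).1.2 else 0) /
  (a + \sum_(i < n) if extends h (tnth p i) then phi (tnth p i).1.2 else a).
Proof.
have -> : \sum_(i < n) (if extends h (tnth p i) then phi (tnth p i).1.2 else a) =
    \sum_(i < n) (if extends h (tnth p i) then phi (tnth p i).1.2 else 0) +
    a * \sum_(i < n) (if ~~ extends h (tnth p i) then 1 else 0).
  rewrite mulr_sumr -big_split; apply: eq_bigr => i _ /=.
  by case: ifP => _; rewrite ?mulr0 ?addr0 ?mulr1 ?add0r.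
rewrite /score; congr (_ / _).
  rewrite /coupled_sum big_mkcond/= big_ord_recl coupled_ref add0r.
  by apply: eq_bigr => i _; rewrite coupled_next theadE tnthS.
rewrite addrCA; congr (_ + _).
  rewrite /coupled_sum big_mkcond/= big_ord_recl coupled_ref add0r.
  by apply: eq_bigr => i _; rewrite coupled_next theadE tnthS.
rewrite /uncoupled big_mkcond/= big_ord_recl coupled_ref/= mulrDr mulr1.
by congr (_ + _ * _); apply: eq_bigr => i _; rewrite coupled_next.
Qed.

End next_generation.
End coupled_particles.

(** A probability kernel keeps the mean of a bounded function within its bounds, so [fine] loses
    nothing and the arithmetic can be done in [R]. *)
Lemma integral_pker_fin d d' (H : measurableType d) (Y : measurableType d')
    (R : realType) (k : R.-pker H ~> Y) h (f : Y -> R) (D : R) :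
  measurable_fun setT f -> (forall y, 0 <= f y <= D) ->
  (\int[k h]_y (f y)%:E = (fine (\int[k h]_y (f y)%:E))%:E)%E /\
  0 <= fine (\int[k h]_y (f y)%:E)%E <= D.
Proof.
move=> mf fD; have f0 y : 0 <= f y by have /andP[] := fD y.
have I0 : (0 <= \int[k h]_y (f y)%:E)%E.
  by apply: integral_ge0 => y _; rewrite lee_fin.
have ID : (\int[k h]_y (f y)%:E <= D%:E)%E.
  rewrite -[leRHS]mule1 -(@prob_kernel _ _ _ _ _ k h) -integral_cst//.
  by apply: le_integral_nonneg => y; rewrite lee_fin//; have /andP[] := fD y.
have If : (\int[k h]_y (f y)%:E \is a fin_num)%E.
  by rewrite ge0_fin_numE// (le_lt_trans ID)// ltry.
by split; [rewrite fineK|rewrite fine_ge0//= -lee_fin fineK].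
Qed.

(* Arithmetic core of [score_step]: [S] and [A] are the sums over the coupled
   particles of the backward image of [phi] and of the weights, [U] is the number
   of uncoupled particles, [V] the larger of the two total weights, and [r] and
   [u] are the probability that a free particle of the next generation extends a
   coupled pair of paths and the mean of [phi] on that event. *)
Lemma step_inequality (R : realFieldType) (n : nat) (S A U V u r a b D : R) :
  (0 < n)%N -> 0 < S -> 0 < V -> 1 <= U -> 0 < a -> 0 <= b -> 0 <= D ->
  S / V <= u -> A / V <= r -> 0 <= r <= 1 ->
  V <= A + b * U -> V <= n.+1%:R * b ->
  S / (S + b * (5 * a + 2 * D) * U) <=
  n%:R * u / (a + (D + a) + (n%:R - 1) * (u + a - a * r)).
Proof.
move=> n0 S0 V0 U1 a0 b0 D0 Su Ar /andP[r0 r1] VA Vb.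
have N1 : 1 <= n%:R :> R by rewrite ler1n.
rewrite -natr1 in Vb; move: n%:R N1 Vb {n0} => N N1 Vb.
have u0 : 0 < u by apply: lt_le_trans Su; rewrite divr_gt0.
have SuV : S <= u * V by rewrite -ler_pdivrMr.
have ArV : A <= r * V by rewrite -ler_pdivrMr.
have U0 : 0 < U by exact: lt_le_trans U1.
have b'0 : 0 <= b * (5 * a + 2 * D) * U.
  by rewrite !mulr_ge0 ?addr_ge0 ?mulr_ge0// ltW.
have w0 : 0 <= (N - 1) * (u + a - a * r).
  have ar : a * r <= a by rewrite ger_pMr.
  by rewrite mulr_ge0 ?subr_ge0//; lra.
rewrite ler_pdivrMr; last by rewrite ltr_wpDr.
rewrite mulrAC ler_pdivlMr; last by rewrite ltr_wpDr//; lra.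
(* Since [A <= r * V], the left side is at most [V - A], the part of the weight controlled by the
   uncoupled particles. *)
have rV : (1 - r) * V <= b * U by nra.
(* Here [N + 1 <= 2 * N], and [U >= 1] inserts the factor [U] that the other estimate carries
   already. *)
have VN : V <= 2 * N * b * U.
  have NU : N <= N * U by rewrite ler_peMr// (le_trans ler01).
  apply: (le_trans Vb); rewrite mulrAC ler_wpM2r//; lra.
(* Origin of the constant [5 * a + 2 * D]: the first term costs [4 * a + 2 * D], the second one more
   [a]. *)
have key : (2 * a + D) * V + (N - 1) * a * ((1 - r) * V) <=
    N * (b * (5 * a + 2 * D) * U).
  have h1 : (2 * a + D) * V <= (2 * a + D) * (2 * N * b * U).
    by rewrite ler_wpM2l// addr_ge0// ?mulr_ge0// ltW.
  have h2 : (N - 1) * a * ((1 - r) * V) <= N * a * (b * U).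
    apply: ler_pM => //.
    - by rewrite mulr_ge0 ?subr_ge0// ltW.
    - by rewrite mulr_ge0 ?subr_ge0// ltW.
    - by rewrite ler_wpM2r ?(ltW a0)// gerBl.
  by apply: (le_trans (lerD h1 h2)); rewrite le_eqVlt; apply/orP; left;
    apply/eqP; ring.
(* Through [S <= u * V], the estimate [key] multiplied by [u] becomes the cross-multiplied goal, up
   to [S * u * (N - 1) <= S * u * N]. *)
have Sx x : 0 <= x -> S * x <= u * (V * x).
  by move=> x0; rewrite mulrA ler_wpM2r.
have c0 : 0 <= 2 * a + D by rewrite addr_ge0 ?mulr_ge0// ltW.
have d0 : 0 <= (N - 1) * a * (1 - r) by rewrite !mulr_ge0 ?subr_ge0// ltW.
have := ler_wpM2l (ltW u0) key; have := Sx _ c0; have := Sx _ d0.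
have : S * u * (N - 1) <= S * u * N by rewrite ler_wpM2l ?mulr_ge0 ?gerBl// ltW.
lra.
Qed.

(** * The score as a lower bound at the output, and its one-step recursion *)

Section score_bounds.
Context d (X : measurableType d) (R : realType).
Variable mu : {sigma_finite_measure set X -> \bar R}.
Variable m : model mu.
Hypothesis mdiag : measurable [set p : X * X | p.1 = p.2].
Variable K : nat -> R.-pker (X * X) ~> (X * X)%type.
Variables (n : nat) (v : prob_vector R n.+1).

Local Notation particle := ('I_n.+1 * X)%type.
Local Notation particle_pair := (particle * particle)%type.
Local Notation generation := (n.+1.-tuple particle_pair).
Local Notation history t := (t.-tuple generation).

Local Notation max_weight t g :=
  (Num.max (\sum_i weight m fst t g i) (\sum_i weight m snd t g i)).

Let pot_ge0 := potential_ge0 m.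

Lemma weight_coupled t (h : history t.+1) i : coupled h i ->
  weight m snd t.+1 (thead h) i = weight m fst t.+1 (thead h) i.
Proof. by move=> /coupled_pos hi; rewrite /weight hi. Qed.

(** A coupled particle has the same weight on both sides, and any other particle has weight at most
    [b]. *)
Lemma max_weight_le t (h : history t.+1) (b : R) :
  (forall x, potential m t.+1 x <= b) ->
  max_weight t.+1 (thead h) <=
    coupled_sum (potential m t.+1) h + b * uncoupled R h.
Proof.
move=> potb; have half side :
    (forall i, coupled h i -> weight m side t.+1 (thead h) i =
      potential m t.+1 (tnth (thead h) i).1.2) ->
    \sum_i weight m side t.+1 (thead h) i <=
      coupled_sum (potential m t.+1) h + b * uncoupled R h.
  move=> wE; rewrite (bigID (coupled h))/= (eq_bigr _ wE) lerD2l.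
  by rewrite /uncoupled mulr_sumr ler_sum// => i _; rewrite mulr1 /weight.
rewrite ge_max half//=.
by apply: half => i hi; rewrite weight_coupled.
Qed.

Lemma max_weight_le_card t (g : generation) (b : R) :
  (forall x, potential m t x <= b) -> max_weight t g <= n.+1%:R * b.
Proof.
move=> potb; rewrite ge_max; apply/andP; split;
  by rewrite (le_trans (ler_sum _ (fun i _ => potb _)))// sumr_const card_ord
    mulr_natl.
Qed.

Lemma coupled_weight_le t (h : history t.+1) :
  coupled_sum (potential m t.+1) h <= max_weight t.+1 (thead h).
Proof.
rewrite le_max; apply/orP; left; rewrite [leRHS](bigID (coupled h))/=.
by rewrite lerDl sumr_ge0// => i _; exact: pot_ge0.
Qed.

(** The right side is the coupled sum over the maximal weight, which [max_weight_le] bounds by the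
    denominator of the score. A zero coupled sum is treated apart, as the maximal weight may then
    vanish. *)
Lemma score_potential_le t (h : history t.+1) (b : R) : 0 <= b ->
  (forall x, potential m t.+1 x <= b) ->
  score (potential m t.+1) b h <=
    \sum_(j | coupled h j) (weight m fst t.+1 (thead h) j /
                            max_weight t.+1 (thead h)).
Proof.
move=> b0 potb; rewrite -mulr_suml -/(coupled_sum (potential m t.+1) h) /score.
have S0 : 0 <= coupled_sum (potential m t.+1) h by exact: coupled_sum_ge0.
have [->|SN0] := eqVneq (coupled_sum (potential m t.+1) h) 0.
  by rewrite !mul0r.
have Sp : 0 < coupled_sum (potential m t.+1) h by rewrite lt_def SN0.
have Vp := lt_le_trans Sp (coupled_weight_le h).
have VS := max_weight_le h potb.
by rewrite ler_wpM2l// lef_pV2// posrE// (lt_le_trans Vp).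
Qed.

Local Open Scope ereal_scope.

(** When both final indices equal the same coupled particle, the output paths agree; given the
    history, this has at least the probability [score_potential_le] provides. *)
Lemma le_ccpf_law t (sref sref' : t.+1.-tuple X) (b : R) : (0 <= b)%R ->
  (forall x, potential m t.+1 x <= b)%R ->
  \int[history_law m mdiag K v sref sref' t.+1 tt]_h
    (score (potential m t.+1) b h)%:E <=
  ccpf_law m mdiag K v sref sref'
    [set s : t.+1.-tuple X * t.+1.-tuple X | s.1 = s.2].
Proof.
move=> b0 potb; set A := [set s | _].
have mA : measurable A by exact: measurable_eq_tuple.
rewrite -[leRHS]/(ccpf_kernel m mdiag K v sref sref' tt A).
rewrite -[A]setIT -integral_indic//.
have [mout ->] : exists mout, ccpf_kernel m mdiag K v sref sref' =
    kbind (history_law m mdiag K v sref sref' t.+1)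
      (kbind (kcomap measurable_snd (final_indices m v t.+1))
        (kret (f := fun p : unit * history t.+1 * ('I_n.+1 * 'I_n.+1) =>
          (ancestral_path fst p.1.2 p.2.1, ancestral_path snd p.1.2 p.2.2))
        mout)) by eexists; reflexivity.
have mA1 : measurable_fun setT (fun z => (\1_A z)%:E : \bar R).
  exact/measurable_EFinP.
have A1 z : 0 <= (\1_A z)%:E :> \bar R by rewrite lee_fin.
rewrite [leRHS]integral_kbind//; apply: le_integral_nonneg => h.
  by rewrite lee_fin score_ge0.
rewrite integral_kmap//.
rewrite -[kcomap _ _ _]/(resample m v t.+1 (thead h)).
have cpos j : coupled h j -> (tnth (thead h) j).1.2 = (tnth (thead h) j).2.2.
  exact: coupled_pos.
set phi := fun ij => _.
have phi0 ij : 0 <= phi ij by exact: A1.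
apply: (le_trans _ (le_integral_resample m v t.+1 cpos phi0)).
apply: (@le_trans _ _ (\sum_(j | coupled h j) (weight m fst t.+1 (thead h) j /
                            max_weight t.+1 (thead h))%:E)).
  by rewrite sumEFin lee_fin score_potential_le.
apply: lee_sum => j /andP[_ /asboolP hj].
by rewrite /phi indicE mem_set ?mule1.
Qed.

(** Given [h], the free particles are independent draws, so [integral_kiid_ratio] applies to the
    form of the score in [score_next]; [step_inequality] then compares the result with a score one
    generation earlier. *)
Lemma score_step t (h : history t.+1) (r : particle_pair) (phi : X -> R)
    (D a b : R) :
  (0 < n)%N -> measurable_fun setT phi -> (forall x, 0 <= phi x <= D)%R ->
  (0 < a)%R -> (0 <= b)%R -> (forall x, potential m t.+1 x <= b)%R ->
  (score (fun x => potential m t.+1 x *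
      fine (\int[trans_kernel m t.+2 x]_y (phi y)%:E))
    (b * (5 * a + 2 * D)) h)%:E <=
  \int[free_pairs m mdiag K v t.+1 h]_p
    (score phi a [tuple of [tuple of r :: p] :: h])%:E.
Proof.
move=> n0 mphi phiD a0 b0 potb.
have phi0 x : (0 <= phi x)%R by have /andP[] := phiD x.
have phileD x : (phi x <= D)%R by have /andP[] := phiD x.
have D0 : (0 <= D)%R by apply: le_trans (phileD point).
set phi' := fun x => _; set b' := (b * _)%R.
have phi'0 x : (0 <= phi' x)%R.
  rewrite mulr_ge0// fine_ge0// integral_ge0// => y _.
  by rewrite lee_fin.
have [S0|SN0] := eqVneq (coupled_sum phi' h) 0%R.
  rewrite /score S0 mul0r; apply: integral_ge0 => p _.
  by rewrite lee_fin score_ge0// ltW.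
have S0 : (0 < coupled_sum phi' h)%R by rewrite lt_def SN0 coupled_sum_ge0.
under eq_integral do rewrite score_next.
pose k := next_pair m mdiag K v t.+2.
rewrite -[free_pairs m mdiag K v t.+1 h]/(kiid k n (thead h)).
set F := fun q : particle_pair => (if extends h q then phi q.1.2 else 0)%R.
pose G := fun q : particle_pair => (if extends h q then phi q.1.2 else a)%R.
pose E := fun q : particle_pair => (if extends h q then 1 else 0 : R)%R.
have mpos : measurable_fun setT (fun q : particle_pair => phi q.1.2).
  apply: (measurableT_comp mphi); apply: (measurableT_comp measurable_snd).
  exact: measurable_fst.
have mext : measurable_fun setT (extends h) by exact: measurable_extends.
have mF : measurable_fun setT F by exact: measurable_fun_ifT.
have mG : measurable_fun setT G by exact: measurable_fun_ifT.
have mE : measurable_fun setT E by exact: measurable_fun_ifT.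
have FD q : (0 <= F q <= D)%R by rewrite /F; case: ifP => //; rewrite lexx.
have GD q : (0 <= G q <= D + a)%R.
  by rewrite /G; case: ifP => _;
    rewrite ?phi0 ?(ltW a0) ?lerDr ?(le_trans (phileD _)) ?lerDl ?(ltW a0).
have E1 q : (0 <= E q <= 1)%R by rewrite /E; case: ifP => _; rewrite lexx ler01.
have [intF /andP[u0 _]] := integral_pker_fin k (thead h) mF FD.
have [intG _] := integral_pker_fin k (thead h) mG GD.
have [intE r01] := integral_pker_fin k (thead h) mE E1.
move: (fine _) intF u0 => u intF u0.
move: (fine _) intG => w intG.
move: (fine _) intE r01 => e intE e01.
have F0 q : (0 <= F q)%R by have /andP[] := FD q.
have G0 q : (0 <= G q)%R by have /andP[] := GD q.
have E0 q : (0 <= E q)%R by have /andP[] := E1 q.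
(* Pointwise [G + a E = F + a], so the means [u] and [e] determine [w]. *)
have wE : (w = u + a - a * e)%R.
  suff : (w + a * e = u + a)%R by move=> <-; rewrite addrK.
  apply: EFin_inj; rewrite !EFinD EFinM -intF -intG -intE.
  rewrite -ge0_integralZl_EFin//; [|by move=> q _; rewrite lee_fin
    |exact/measurable_EFinP|exact: ltW].
  rewrite -[in RHS](mule1 a%:E) -[in RHS](@prob_kernel _ _ _ _ _ k (thead h)).
  rewrite -integral_cst// -!ge0_integralD//; last first.
  - by apply: emeasurable_funM => //; exact/measurable_EFinP.
  - by move=> q _; rewrite mule_ge0 ?lee_fin// ltW.
  - exact/measurable_EFinP.
  - by move=> q _; rewrite lee_fin.
  - by move=> q _; rewrite lee_fin ltW.
  - exact/measurable_EFinP.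
  - by move=> q _; rewrite lee_fin.
  apply: eq_integral => q _; rewrite -EFinM -!EFinD /F /G /E.
  by case: ifP => _; rewrite ?mulr1 ?mulr0 ?addr0 ?add0r.
(* Used twice: for [phi] it gives the lower bound on [u], and for the constant 1 the one on [e]. *)
have low (f : X -> R) (Fq : particle_pair -> R) : (forall x, 0 <= f x)%R ->
    (forall x, \int[trans_kernel m t.+2 x]_y (f y)%:E =
      (fine (\int[trans_kernel m t.+2 x]_y (f y)%:E))%:E) ->
    (forall q, 0 <= Fq q)%R -> measurable_fun setT Fq ->
    (forall q, extends h q -> Fq q = f q.1.2) ->
    ((coupled_sum (fun x => potential m t.+1 x *
      fine (\int[trans_kernel m t.+2 x]_y (f y)%:E)) h /
      max_weight t.+1 (thead h))%:E <= \int[k (thead h)]_q (Fq q)%:E).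
  move=> f0 fint Fq0 mFq Fqf.
  apply: (le_trans _ (@le_integral_next_pair _ _ _ _ _ mdiag K _ v _ _
    (fun j => coupled h j) _ (fun x => (f x)%:E) _ _ _ _)) => //.
  - rewrite /coupled_sum mulr_suml -sumEFin; apply: lee_sum => j _.
    by rewrite fint -EFinM lee_fin mulrAC.
  - exact/measurable_EFinP.
  - by move=> j; exact: coupled_pos.
  - move=> j x /andP[_ /asboolP hj]; rewrite Fqf//; apply/asboolP.
    exact: (congr1 (fun p : t.+1.-tuple X => [tuple of rcons p x]) hj).
have FE q : extends h q -> F q = phi q.1.2 by rewrite /F => ->.
have Su := low phi F phi0 (fun x => (integral_pker_fin _ x mphi phiD).1) F0 mF FE.
have int1 x : \int[trans_kernel m t.+2 x]_y ((cst 1%R : X -> R) y)%:E = 1%:E.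
  transitivity (\int[trans_kernel m t.+2 x]_y (cst 1%:E y)) => //.
  by rewrite integral_cst// prob_kernel mule1.
have Ar : ((coupled_sum (potential m t.+1) h / max_weight t.+1 (thead h))%:E <=
    \int[k (thead h)]_q (E q)%:E).
  rewrite (_ : potential m t.+1 = fun x => potential m t.+1 x *
      fine (\int[trans_kernel m t.+2 x]_y ((cst 1%R : X -> R) y)%:E))%R.
    apply: low => //; first by move=> x; rewrite int1.
    by move=> q; rewrite /E => ->.
  by apply/funext => x; rewrite int1 mulr1.
move: Su Ar; rewrite intF intE !lee_fin => Su Ar.
(* As [phi'] is at most [D] times the potential, a positive coupled sum forces a positive coupled
   weight. *)
have V0 : (0 < max_weight t.+1 (thead h))%R.
  have SD : (coupled_sum phi' h <= D * coupled_sum (potential m t.+1) h)%R.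
    rewrite /coupled_sum mulr_sumr; apply: ler_sum => i _.
    rewrite /phi' [leRHS]mulrC ler_wpM2l ?potential_ge0//.
    by have [_ /andP[]] := integral_pker_fin (trans_kernel m t.+2)
      (tnth (thead h) i).1.2 mphi phiD.
  rewrite ltNge; apply/negP => V0; move: S0; rewrite ltNge => /negP; apply.
  apply: (le_trans SD); rewrite mulr_ge0_le0//.
  exact: le_trans (coupled_weight_le h) V0.
apply: (le_trans _ (integral_kiid_ratio mF mG F0 G0 intF intG n _ a0)); last first.
  by move=> q; have /andP[_] := GD q; exact.
rewrite lee_fin wE; apply: (step_inequality n0 S0 V0 _ a0 b0 D0 Su Ar e01 _ _).
- exact: uncoupled_ge1.
- exact: max_weight_le.
- exact: max_weight_le_card.
Qed.

End score_bounds.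

(** * Backward functions and the normalizing constant *)

Section backward_functions.
Context d (X : measurableType d) (R : realType).
Variable mu : {sigma_finite_measure set X -> \bar R}.
Variable m : model mu.

(** For bounded potentials, where [fine] changes nothing, this is the mean of the product of the
    potentials at times [t] to [t + k], given the state [x] at time [t]. *)
Fixpoint backward (k t : nat) : X -> R :=
  match k with
  | 0 => potential m t
  | k'.+1 => fun x => potential m t x *
      fine (\int[trans_kernel m t.+1 x]_y (backward k' t.+1 y)%:E)
  end.

(* [/=] would also unfold the kernel, on which unification then diverges. *)
Lemma backwardS k t x : backward k.+1 t x = potential m t x *
  fine (\int[trans_kernel m t.+1 x]_y (backward k t.+1 y)%:E).
Proof. by []. Qed.

Lemma backward_ge0 k t x : 0 <= backward k t x.
Proof.
elim: k t x => [|k IHk] t x; first exact: potential_ge0.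
rewrite backwardS; apply: mulr_ge0; first exact: potential_ge0.
by apply: fine_ge0; apply: integral_ge0 => y _; rewrite lee_fin.
Qed.

Lemma measurable_backward k t : measurable_fun setT (backward k t).
Proof.
elim: k t => [|k IHk] t; first exact: measurable_potential.
rewrite (funext (backwardS k t)).
apply: measurable_funM; first exact: measurable_potential.
apply: (measurableT_comp (fine_measurable measurableT)).
apply: (measurable_fun_integral_kernel
  (l := fun x => trans_kernel m t.+1 x) _ _ _) => //.
- by move=> U mU; exact: measurable_kernel.
- by move=> y; rewrite lee_fin backward_ge0.
- exact/measurable_EFinP.
Qed.

Lemma backward_le (b : R) k t :
  (forall s x, (t <= s <= t + k)%N -> potential m s x <= b) ->
  forall x, backward k t x <= b ^+ k.+1.
Proof.
elim: k t => [|k IHk] t potb x; first by rewrite potb// addn0 leqnn.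
have IH := IHk t.+1.
have potb' s y : (t.+1 <= s <= t.+1 + k)%N -> potential m s y <= b.
  by move=> /andP[ts sk]; rewrite potb// (ltnW ts)/= addnS.
rewrite backwardS exprS ler_pM ?potential_ge0//.
- by apply: fine_ge0; apply: integral_ge0 => y _; rewrite lee_fin backward_ge0.
- by rewrite potb// leqnn leq_addr.
have [|_ /andP[]//] := integral_pker_fin (trans_kernel m t.+1) x
  (D := b ^+ k.+1) (measurable_backward k t.+1).
by move=> y; rewrite backward_ge0 IH.
Qed.

(** A recursive form of the product in [normalizing_constant], matching [iterated_integral]: [s]
    lists the states from time [t] on, and [x] is the state before. *)
Fixpoint path_weight (t : nat) (x : X) (s : seq X) : R :=
  match s with
  | [::] => 1
  | y :: s' => trans_dens m t x y * potential m t y * path_weight t.+1 y s'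
  end.

Lemma path_weightE t x s :
  \prod_(0 <= j < size s) (trans_dens m (t + j) (nth point (x :: s) j)
                                      (nth point (x :: s) j.+1) *
                           potential m (t + j) (nth point (x :: s) j.+1)) =
  path_weight t x s.
Proof.
elim: s t x => [|y s IHs] t x; first by rewrite big_nil.
rewrite /= big_nat_recl//= addn0 -IHs; congr (_ * _).
by apply: eq_bigr => j _; rewrite addSnnS.
Qed.

Local Open Scope ereal_scope.

Lemma eq_iterated_integral k (f g : seq X -> \bar R) :
  (forall s, size s = k -> f s = g s) ->
  iterated_integral mu k f = iterated_integral mu k g.
Proof.
elim: k f g => [|k IHk] f g fg /=; first exact: fg.
by apply: eq_integral => x _; apply: IHk => s sk; apply: fg; rewrite /= sk.
Qed.

Lemma integral_trans_kernel t x (phi : X -> R) :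
  measurable_fun setT phi -> (forall y, 0 <= phi y)%R ->
  \int[trans_kernel m t x]_y (phi y)%:E =
  \int[mu]_y (trans_dens m t x y * phi y)%:E.
Proof.
move=> mphi phi0; rewrite integral_kdensity//.
exact/measurable_EFinP.
Qed.

(** The constant [c] holds the factors of the outer variables, so that the induction can absorb
    [potential m t x] and the next transition density. The bound [b] gives the finiteness that
    removes [fine]. *)
Lemma iterated_integral_path_weight (b : R) k t x (c : R) : (0 <= c)%R ->
  (forall s x, (t.+1 <= s <= t + k)%N -> potential m s x <= b)%R ->
  iterated_integral mu k
    (fun s => (c * potential m t x * path_weight t.+1 x s)%:E) =
  (c * backward k t x)%:E.
Proof.
move=> + potb; elim: k t x c potb => [|k IHk] t x c potb c0.
  by rewrite /= mulr1.
have potb' s y : (t.+2 <= s <= t.+1 + k)%N -> (potential m s y <= b)%R.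
  by move=> /andP[ts sk]; rewrite potb// (ltnW ts)/= addnS.
rewrite backwardS; transitivity (\int[mu]_y ((c * potential m t x)%:E *
    (trans_dens m t.+1 x y * backward k t.+1 y)%:E)).
  apply: eq_integral => y _; rewrite -EFinM mulrA -IHk//.
    by apply: eq_iterated_integral => s _; rewrite /= !mulrA.
  by rewrite !mulr_ge0 ?potential_ge0// trans_dens_ge0.
have B0 := backward_ge0 k t.+1; have mB := measurable_backward k t.+1.
rewrite ge0_integralZl_EFin//; last 3 first.
- by move=> y _; rewrite lee_fin mulr_ge0// trans_dens_ge0.
- apply/measurable_EFinP; apply: measurable_funM => //.
  exact: (measurableT_comp (measurable_trans_dens m t.+1) (pair1_measurable x)).
- by rewrite mulr_ge0// potential_ge0.
rewrite -integral_trans_kernel//.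
have bB y : (0 <= backward k t.+1 y <= b ^+ k.+1)%R.
  by rewrite B0 backward_le// => s z; rewrite addSnnS; exact: potb.
have [intB _] := integral_pker_fin (trans_kernel m t.+1) x mB bB.
by rewrite [in LHS]intB -EFinM mulrA.
Qed.

Lemma normalizing_constantE (b : R) k :
  (forall s x, (1 <= s <= k.+1)%N -> potential m s x <= b)%R ->
  normalizing_constant m k.+1 =
  \int[mu]_x (init_dens m x * backward k 1 x)%:E.
Proof.
move=> potb; rewrite /normalizing_constant /=; apply: eq_integral => x _.
rewrite -(@iterated_integral_path_weight b)//; last 2 first.
- exact: init_dens_ge0.
- by move=> s y /andP[s1 sk]; rewrite potb// (ltnW s1).
apply: eq_iterated_integral => s sk; congr (_ * _)%:E.
(* The factor at time [t] gets the index [t - 2], since the state at time 1 is the outer variable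
   [x]. *)
rewrite -path_weightE sk -{1}[2%N]add0n big_addn subSS subSS subn0.
by apply: eq_bigr => j _; rewrite addn2.
Qed.

End backward_functions.

(* The constants [a] that repeated use of [score_step] produces. *)
Fixpoint penalty (R : realType) (b : R) (k : nat) : R :=
  match k with
  | 0 => b
  | k'.+1 => b * (5 * penalty b k' + 2 * b ^+ k'.+1)
  end.

Lemma penalty_gt0 (R : realType) (b : R) k : 0 < b -> 0 < penalty b k.
Proof.
by move=> b0; elim: k => //= k IHk; rewrite mulr_gt0// addr_gt0// mulr_gt0//
  exprn_gt0.
Qed.

(** * Recursion over time and the bound for [n] free particles *)

Section lower_bound.
Context d (X : measurableType d) (R : realType).
Variable mu : {sigma_finite_measure set X -> \bar R}.
Variable m : model mu.
Hypothesis mdiag : measurable [set p : X * X | p.1 = p.2].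
Variable K : nat -> R.-pker (X * X) ~> (X * X)%type.
Variables (n : nat) (v : prob_vector R n.+1).
Hypothesis n0 : (0 < n)%N.

Local Notation particle := ('I_n.+1 * X)%type.
Local Notation particle_pair := (particle * particle)%type.
Local Notation generation := (n.+1.-tuple particle_pair).
Local Notation history t := (t.-tuple generation).

Local Open Scope ereal_scope.

(** Before time 1 the paths are empty, and the two positions of a free particle are equal; so all
    free particles are coupled, and both sums have mean [u] per draw. *)
Lemma score_initial (h : history 0) (r : particle_pair) (phi : X -> R)
    (D a u : R) :
  measurable_fun setT phi -> (forall x, 0 <= phi x <= D)%R -> (0 < a)%R ->
  \int[mu]_x (init_dens m x * phi x)%:E = u%:E ->
  (n%:R * u / (a + (D + a) + (n%:R - 1) * u))%:E <=
  \int[free_pairs m mdiag K v 0 h]_p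
    (score phi a [tuple of [tuple of r :: p] :: h])%:E.
Proof.
move=> mphi phiD a0 phiu.
have phi0 x : (0 <= phi x)%R by have /andP[] := phiD x.
have phileD x : (phi x <= D)%R by have /andP[] := phiD x.
under eq_integral do rewrite score_next.
pose k := initial_pair m n (history 0).
rewrite -[free_pairs m mdiag K v 0 h]/(kiid k n h).
have mext : measurable_fun setT (extends h) by exact: measurable_extends.
have intk (f : particle_pair -> R) : measurable_fun setT f ->
    (forall q, 0 <= f q)%R ->
    (forall q, extends h q -> f q = phi q.1.2) ->
    \int[k h]_q (f q)%:E = u%:E.
  move=> mf f0 fphi.
  have [minit ->] : exists minit, k = kbind (init_kernel (history 0) m)
      (kret (f := fun p : history 0 * X =>
        ((ord0, p.2), (ord0, p.2)) : particle_pair) minit).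
    by eexists; reflexivity.
  rewrite integral_kmap//; last exact/measurable_EFinP.
  rewrite -phiu.
  have ext x : extends h ((ord0, x), (ord0, x)) by exact/asboolP.
  under eq_integral do rewrite fphi//.
  rewrite [LHS]integral_kdensity//.
  exact/measurable_EFinP.
have mpos : measurable_fun setT (fun q : particle_pair => phi q.1.2).
  apply: (measurableT_comp mphi); apply: (measurableT_comp measurable_snd).
  exact: measurable_fst.
apply: (integral_kiid_ratio (k := k) (h := h)
  (F := fun q => if extends h q then phi q.1.2 else 0%R)
  (G := fun q => if extends h q then phi q.1.2 else a)) => //.
- exact: measurable_fun_ifT.
- exact: measurable_fun_ifT.
- by move=> q; case: ifP.
- by move=> q; case: ifP => // _; exact: ltW.
- apply: intk; first exact: measurable_fun_ifT.
    by move=> q; case: ifP.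
  by move=> q ->.
- apply: intk; first exact: measurable_fun_ifT.
    by move=> q; case: ifP => // _; exact: ltW.
  by move=> q ->.
- move=> q; case: ifP => _; first by rewrite (le_trans (phileD _))// lerDl ltW.
  by rewrite lerDr (le_trans (phi0 point)).
Qed.

(** Induction on the number [k] of generations still to come, with [T] fixed: [le_ccpf_law] is the
    base, and [score_step] with [D = b ^+ k.+1] reproduces the recursion of [penalty]. *)
Lemma score_backward_le (b : R) k t T (sref sref' : T.-tuple X) :
  (0 < b)%R -> (t + k).+1 = T ->
  (forall s x, (1 <= s <= T)%N -> potential m s x <= b)%R ->
  \int[history_law m mdiag K v sref sref' t.+1 tt]_h
    (score (backward m k t.+1) (penalty b k) h)%:E <=
  ccpf_law m mdiag K v sref sref' [set s : T.-tuple X * T.-tuple X | s.1 = s.2].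
Proof.
move=> b0; elim: k t => [|k IHk] t tT potb.
  rewrite addn0 in tT; subst T; apply: le_ccpf_law; first exact: ltW.
  by move=> x; rewrite potb//= leqnn.
rewrite addnS -addSn in tT.
apply: le_trans (IHk _ tT potb); have p0 := penalty_gt0 k b0.
have B0 x : (0 <= backward m k t.+2 x)%R by exact: backward_ge0.
have mB := measurable_backward m k t.+2.
rewrite [leRHS]integral_history_law; last 2 first.
- by move=> h; rewrite lee_fin score_ge0// ltW.
- by apply/measurable_EFinP; exact: measurable_score.
apply: le_integral_nonneg => h.
  rewrite lee_fin score_ge0//; first exact: backward_ge0.
  by rewrite ltW// penalty_gt0.
apply: score_step => //; last 2 first.
- exact: ltW.
- by move=> x; rewrite potb//= -tT leqW// leq_addr.
move=> x; rewrite B0 (@backward_le _ _ _ _ _ b)// => s y /andP[ts sk].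
by rewrite potb//= -tT -addSn sk (leq_trans _ ts).
Qed.

(** The preceding bound is taken back to time 1, where the mean of the backward function is the
    normalizing constant. *)
Lemma ccpf_law_diag_ge (b : R) (c : R) k (sref sref' : k.+1.-tuple X) :
  (0 < b)%R -> (0 < c)%R -> normalizing_constant m k.+1 = c%:E ->
  (forall s x, (1 <= s <= k.+1)%N -> potential m s x <= b)%R ->
  (n%:R * c / (2 * penalty b k + b ^+ k.+1 + (n%:R - 1) * c))%:E <=
  ccpf_law m mdiag K v sref sref'
    [set s : k.+1.-tuple X * k.+1.-tuple X | s.1 = s.2].
Proof.
move=> b0 c0 Zc potb.
apply: le_trans (score_backward_le (t := 0) (k := k) sref sref' b0 _ potb) => //.
have p0 := penalty_gt0 k b0; have mB := measurable_backward m k 1.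
have B0 x : (0 <= backward m k 1 x)%R by exact: backward_ge0.
rewrite integral_history_law; last 2 first.
- by move=> h; rewrite lee_fin score_ge0// ltW.
- by apply/measurable_EFinP; exact: measurable_score.
(* The constant bound is written as its own integral over the empty history, so that the integrands
   can be compared. *)
rewrite -[leLHS]mule1 -(@prob_kernel _ _ _ _ _ (history_law m mdiag K v sref sref' 0) tt).
rewrite -integral_cst//; apply: le_integral_nonneg => h.
  have N1 : (1 <= n%:R :> R)%R by rewrite ler1n.
  by rewrite /= lee_fin divr_ge0// ?addr_ge0 ?mulr_ge0 ?subr_ge0 ?exprn_ge0// ltW.
rewrite (_ : 2 * _ + _ = penalty b k + (b ^+ k.+1 + penalty b k))%R; last by ring.
apply: score_initial => //.
  by move=> x; rewrite B0 (@backward_le _ _ _ _ _ b).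
by rewrite -(@normalizing_constantE _ _ _ _ _ b).
Qed.

End lower_bound.

Theorem theorem8 (R : realType) (Gstar : R) (T : nat) (cT : R) :
  (1 <= T)%N -> 0 < cT ->
  exists c : R, 0 < c /\
    forall (d : measure_display) (X : measurableType d)
      (mu : {sigma_finite_measure set X -> \bar R}) (m : model mu)
      (mdiag : measurable [set p : X * X | p.1 = p.2])
      (K : nat -> R.-pker (X * X) ~> (X * X)%type),
    normalizing_constant m T = cT%:E ->
    (forall (t : nat) (x : X), (1 <= t <= T)%N -> potential m t x <= Gstar) ->
    is_coupling_upto m T K ->
    forall (N : nat) (v : prob_vector R N.-1.+1) (sref sref' : T.-tuple X),
      (2 <= N)%N ->
      ((1 - c / (N%:R + c))%:E <=
       ccpf_law m mdiag K v sref sref'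
         [set s : T.-tuple X * T.-tuple X | s.1 = s.2])%E.
Proof.
case: T => // k _ cT0.
(* Both depend on [Gstar], the horizon and [cT] only. The maximum makes [b] positive, and the
   division prepares for cancelling [cT] in the bound. *)
pose b := Num.max Gstar 1; pose e := (2 * penalty b k + b ^+ k.+1) / cT.
have b0 : 0 < b by rewrite lt_max ltr01 orbT.
have e0 : 0 < e.
  by rewrite divr_gt0// addr_gt0 ?exprn_gt0// mulr_gt0// penalty_gt0.
(* The factor 2 pays for passing from [n] free particles to [N = n + 1]: after cross-multiplication
   [e <= n * e + n + 1] remains, which holds as [n >= 1]. *)
exists (2 * e); split; first by rewrite mulr_gt0.
move=> d X mu m mdiag K Zc potG _ [|n] v sref sref' // n0.
have potb t x : (1 <= t <= k.+1)%N -> potential m t x <= b.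
  by move=> tT; rewrite le_max potG.
apply: le_trans (ccpf_law_diag_ge mdiag K v n0 sref sref' b0 cT0 Zc potb).
rewrite lee_fin.
have eE : 2 * penalty b k + b ^+ k.+1 = e * cT by rewrite divfK// gt_eqF.
rewrite eE -mulrDl -mulf_div divff ?gt_eqF// mulr1.
have N1 : 1 <= n%:R :> R by rewrite ler1n.
rewrite -[n.+1%:R]natr1; move: (n%:R) N1 => x x1.
rewrite [leLHS](_ : _ = (x + 1) / (x + 1 + 2 * e)); last by field; rewrite gt_eqF//; lra.
rewrite ler_pdivrMr; last lra.
rewrite mulrAC ler_pdivlMr; last lra.
nra.
Qed.
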